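(* For every $r>0$ there is $\varepsilon_r>0$ and a simple branching algorithm which, given any set system $(U,\mathcal F)$ with $|U|\le r\cdot|\mathcal F|$, enumerates all minimal set covers of $(U,\mathcal F)$ in $O^*\left(2^{(1-\varepsilon_r)|\mathcal F|}\right)$ time.
   Context: A set cover of $(U,\mathcal F)$ is a subfamily $\mathcal S\subseteq\mathcal F$ whose union is $U$; it is minimal if no proper subfamily is a set cover. A simple branching algorithm is a classical branching algorithm in which the exploration of each root-to-leaf path of its search tree is independent of the other paths; it enumerates a family if each leaf finds at most one member and collectively the leaves find all members (duplicates allowed). $O^*$ hides polynomial factors. *)

(* Defs.v *)
From HB Require Import structures.
From mathcomp Require Import all_boot.

Set Implicit Arguments.
Unset Strict Implicit.
Unset Printing Implicit Defensive.

(* Model of computation: Jones's WHILE language over binary trees, extended   *)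
(* with a binary branching command. Trees are immutable and the only test is  *)
(* emptiness, so every atomic command takes constant time on a RAM (trees     *)
(* being represented by pointers, with sharing), for a fixed program.         *)
Inductive data := Nil | Cons of data & data.

Definition data_comparable : comparable data.
Proof. by rewrite /comparable /decidable; decide equality. Defined.

HB.instance Definition _ := hasDecEq.Build data (compareP data_comparable).

Definition hd (d : data) := if d is Cons a _ then a else Nil.
Definition tl (d : data) := if d is Cons _ b then b else Nil.

Inductive expr :=
| EVar of nat
| ENil
| ECons of expr & expr
| EHd of expr
| ETl of expr.

Inductive cmd :=
| Skip
| Assign of nat & expr
| Seq of cmd & cmd
| If of expr & cmd & cmd
| While of expr & cmd
| Branch of cmd & cmd.

Definition store := nat -> data.

Definition update (st : store) (x : nat) (d : data) : store :=
  fun y => if y == x then d else st y.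

Fixpoint eval (st : store) (e : expr) : data :=
  match e with
  | EVar x => st x
  | ENil => Nil
  | ECons e1 e2 => Cons (eval st e1) (eval st e2)
  | EHd e1 => hd (eval st e1)
  | ETl e1 => tl (eval st e1)
  end.

Definition truthy (d : data) := d != Nil.

Inductive stree :=
| Leaf of data
| Step of stree
| Fork of stree & stree.

(* search_tree k st t: t is the complete, finite search tree of the execution *)
(* of the commands k, in sequence, from the store st. Both children of a Fork *)
(* start from a copy of the current store and never interact, so that the     *)
(* root-to-leaf paths are explored independently. A leaf returns variable 0.  *)
Inductive search_tree : seq cmd -> store -> stree -> Prop :=
| STLeaf st :
    search_tree [::] st (Leaf (st 0))
| STSkip k st t :
    search_tree k st t -> search_tree (Skip :: k) st (Step t)
| STAssign x e k st t :
    search_tree k (update st x (eval st e)) t ->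
    search_tree (Assign x e :: k) st (Step t)
| STSeq c1 c2 k st t :
    search_tree (c1 :: c2 :: k) st t ->
    search_tree (Seq c1 c2 :: k) st (Step t)
| STIf e c1 c2 k st t :
    search_tree ((if truthy (eval st e) then c1 else c2) :: k) st t ->
    search_tree (If e c1 c2 :: k) st (Step t)
| STWhile e c k st t :
    search_tree (if truthy (eval st e) then c :: While e c :: k else k) st t ->
    search_tree (While e c :: k) st (Step t)
| STBranch c1 c2 k st t1 t2 :
    search_tree (c1 :: k) st t1 -> search_tree (c2 :: k) st t2 ->
    search_tree (Branch c1 c2 :: k) st (Fork t1 t2).

Lemma search_tree_unique k st t1 t2 :
  search_tree k st t1 -> search_tree k st t2 -> t1 = t2.
Proof.
move=> H; elim: H t2 => {k st t1}.
- by move=> st t2 H; inversion H.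
- by move=> k st t _ IH t2 H; inversion H; rewrite (IH t0).
- by move=> x e k st t _ IH t2 H; inversion H; rewrite (IH t0).
- by move=> c1 c2 k st t _ IH t2 H; inversion H; rewrite (IH t0).
- by move=> e c1 c2 k st t _ IH t2 H; inversion H; rewrite (IH t0).
- by move=> e c k st t _ IH t2 H; inversion H; rewrite (IH t0).
- by move=> c1 c2 k st u1 u2 _ IH1 _ IH2 t2 H; inversion H; subst;
    congr Fork; [apply: IH1 | apply: IH2].
Qed.

Fixpoint leaves (t : stree) : seq data :=
  match t with
  | Leaf d => [:: d]
  | Step t1 => leaves t1
  | Fork t1 t2 => leaves t1 ++ leaves t2
  end.

(* Time to explore the whole search tree: its number of nodes. *)
Fixpoint total_time (t : stree) : nat :=
  match t with
  | Leaf _ => 1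
  | Step t1 => (total_time t1).+1
  | Fork t1 t2 => (total_time t1 + total_time t2).+1
  end.

(* Time to explore the longest root-to-leaf path. A branching algorithm spends *)
(* polynomial time on each path; if only total_time were bounded, everything  *)
(* could be computed on one exponentially long path before any branching.     *)
Fixpoint path_time (t : stree) : nat :=
  match t with
  | Leaf _ => 1
  | Step t1 => (path_time t1).+1
  | Fork t1 t2 => (maxn (path_time t1) (path_time t2)).+1
  end.

Definition encode_seq (T : Type) (f : T -> data) (s : seq T) : data :=
  foldr (fun x d => Cons (f x) d) Nil s.

Definition encode_bool (b : bool) : data := if b then Cons Nil Nil else Nil.

Definition encode_bits : bitseq -> data := encode_seq encode_bool.

Definition set_cover (n : nat) (F C : {set {set 'I_n}}) : bool :=
  (C \subset F) && (cover C == [set: 'I_n]).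

Definition minimal_set_cover (n : nat) (F C : {set {set 'I_n}}) : bool :=
  set_cover F C && [forall C' : {set {set 'I_n}},
                      (C' \proper C) ==> ~~ set_cover F C'].

(* The universe in unary, then the characteristic bit vector of each member   *)
(* of the family, in the order of the listing s.                              *)
Definition encode_system (n : nat) (s : seq {set 'I_n}) : data :=
  Cons (encode_seq (fun _ : 'I_n => Nil) (enum 'I_n))
       (encode_seq (fun A : {set 'I_n} =>
                      encode_bits [seq i \in A | i <- enum 'I_n]) s).

(* Nil when nothing is found; otherwise the subfamily C, as a bit vector      *)
(* indexed by the listing s.                                                  *)
Definition encode_answer (n : nat) (s : seq {set 'I_n})
    (o : option {set {set 'I_n}}) : data :=
  if o is Some C then Cons Nil (encode_bits [seq A \in C | A <- s]) else Nil.

Definition initial_store (n : nat) (s : seq {set 'I_n}) : store :=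
  fun x => if x == 0 then encode_system s else Nil.

Definition enumerates (n : nat) (s : seq {set 'I_n}) (t : stree)
    (P : pred {set {set 'I_n}}) : Prop :=
  (forall d, d \in leaves t ->
     d = encode_answer s None \/
     exists2 C : {set {set 'I_n}}, P C & d = encode_answer s (Some C)) /\
  (forall C : {set {set 'I_n}}, P C -> encode_answer s (Some C) \in leaves t).

(* Main.v *)
Require Import Defs.
From mathcomp Require Import all_boot all_order all_algebra.
From mathcomp Require Import reals sequences exp.
From mathcomp Require Import zify ring lra.

(* Exchange the roles of sets and elements: minimal set covers are the minimal
   hitting sets of a hypergraph whose m vertices are the members of the family
   and whose n <= rho * m edges are the elements. A vertex chosen by a minimal
   hitting set T has a private edge, which meets T in that vertex only.

   A state consists of the chosen vertices and of the edges not hit so far,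
   restricted to the undecided vertices. It is branched on as follows, for
   constants D, D' = 2 D and c = 4 D rho.
   - An edge of size k < D: guess its first vertex in T. The branches decide
     1, ..., k vertices, and 1/2 + ... + 2^-k < 1.
   - An edge of size > D': either T avoids its first D' vertices, or the edge can
     be cut down to them, a private edge then remaining private.
   - A vertex v lying in at most c edges: either v is excluded, or v is chosen and
     one of these edges, of size >= D, is its private edge, which excludes all
     its other vertices; 1/2 + c 2^-D < 1.
   - Otherwise every vertex lies in more than c edges of size <= D', so that at
     most m/2 vertices are left by double counting, and a vertex is decided
     arbitrarily.
   When all edges are hit, no undecided vertex can have a private edge, so T is
   the set of chosen vertices. With a slightly larger than 1/2, the number of
   leaves is bounded by the potential a^-u (2 a)^(min u (m/2)) x^b, where u counts
   the vertices left, b the edges of size > D', and x = 1 + 2 a^D'; since a^D' is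
   of order 4^-D while 2 a - 1 is of order 2^-D / D, the factor x^n is harmless.

   The deterministic parts of the algorithm are written in a first-order language
   of functions on trees whose only loop is a fold. Every fold stops after N
   iterations, N being the length of a clock stored in variable 1, so that the
   running time is polynomial in N by construction. *)

Set Implicit Arguments.
Unset Strict Implicit.
Unset Printing Implicit Defensive.
Import Order.TTheory GRing.Theory Num.Theory.
(* mathcomp also defines [Cons]: the name must denote the tree constructor. *)
Import Defs.

(** * A polynomial-time functional language *)

Fixpoint unlist (d : data) : seq data :=
  if d is Cons a b then a :: unlist b else [::].

Lemma unlist_encode_seq (T : Type) (f : T -> data) (s : seq T) :
  unlist (encode_seq f s) = map f s.
Proof. by elim: s => //= x s ->. Qed.

Inductive fn :=
| FId
| FNil
| FCons of fn & fn
| FHd of fn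
| FTl of fn
| FComp of fn & fn
| FIf of fn & fn & fn
| FFold of fn & fn & fn.

Fixpoint den (N : nat) (f : fn) (x : data) : data :=
  match f with
  | FId => x
  | FNil => Nil
  | FCons g h => Cons (den N g x) (den N h x)
  | FHd g => hd (den N g x)
  | FTl g => tl (den N g x)
  | FComp g h => den N g (den N h x)
  | FIf c g h => if truthy (den N c x) then den N g x else den N h x
  | FFold l i b =>
      foldl (fun acc e => den N b (Cons x (Cons e acc))) (den N i x)
            (take N (unlist (den N l x)))
  end.

Local Notation "c1 ;; c2" := (Seq c1 c2) (at level 60, right associativity).

(* [comp f r] replaces the content x of variable r by [den N f x], where N is the
   length of variable 1, and leaves the variables below r unchanged. *)
Fixpoint comp (f : fn) (r : nat) : cmd :=
  match f with
  | FId => Skip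
  | FNil => Assign r ENil
  | FCons g h =>
      Assign r.+1 (EVar r) ;; comp g r.+1 ;;
      Assign r.+2 (EVar r) ;; comp h r.+2 ;;
      Assign r (ECons (EVar r.+1) (EVar r.+2))
  | FHd g => comp g r ;; Assign r (EHd (EVar r))
  | FTl g => comp g r ;; Assign r (ETl (EVar r))
  | FComp g h => comp h r ;; comp g r
  | FIf c g h =>
      Assign r.+1 (EVar r) ;; comp c r.+1 ;;
      If (EVar r.+1) (comp g r) (comp h r)
  | FFold l i b =>
      Assign r.+1 (EVar r) ;; comp l r.+1 ;;
      Assign r.+2 (EVar r) ;; comp i r.+2 ;;
      Assign r.+3 (EVar 1) ;;
      While (EVar r.+3)
        (Assign r.+3 (ETl (EVar r.+3)) ;;
         If (EVar r.+1)
           (Assign r.+4 (ECons (EVar r) (ECons (EHd (EVar r.+1)) (EVar r.+2))) ;;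
            comp b r.+4 ;;
            Assign r.+2 (EVar r.+4) ;;
            Assign r.+1 (ETl (EVar r.+1)))
           Skip) ;;
      Assign r (EVar r.+2)
  end.

(** Only an upper bound: [FIf] is charged for both branches, and [FFold] for N rounds, since its
    loop idles until the clock is used up even when the list is shorter. *)
Fixpoint cost (N : nat) (f : fn) : nat :=
  match f with
  | FId => 1
  | FNil => 1
  | FCons g h => cost N g + cost N h + 7
  | FHd g => cost N g + 2
  | FTl g => cost N g + 2
  | FComp g h => cost N g + cost N h + 1
  | FIf c g h => cost N c + cost N g + cost N h + 4
  | FFold l i b => cost N l + cost N i + N * (cost N b + 20) + 11
  end.

(** * Polynomial bounds on running times *)

Definition poly_bounded (g : nat -> nat) :=
  exists c k, forall N, g N <= c * N.+1 ^ k.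

Lemma poly_bounded_const a : poly_bounded (fun=> a).
Proof. by exists a, 0 => N; rewrite muln1. Qed.

Lemma poly_bounded_id : poly_bounded id.
Proof. by exists 1, 1 => N; rewrite mul1n. Qed.

Lemma poly_bounded_add g h :
  poly_bounded g -> poly_bounded h -> poly_bounded (fun N => g N + h N).
Proof.
move=> [c1 [k1 H1]] [c2 [k2 H2]]; exists (c1 + c2), (k1 + k2) => N.
rewrite mulnDl leq_add //.
  by rewrite (leq_trans (H1 N)) // leq_mul2l leq_pexp2l ?leq_addr ?orbT.
by rewrite (leq_trans (H2 N)) // leq_mul2l leq_pexp2l ?leq_addl ?orbT.
Qed.

Lemma poly_bounded_mul g h :
  poly_bounded g -> poly_bounded h -> poly_bounded (fun N => g N * h N).
Proof.
move=> [c1 [k1 H1]] [c2 [k2 H2]]; exists (c1 * c2), (k1 + k2) => N.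
by rewrite expnD mulnACA leq_mul.
Qed.

Lemma cost_poly_bounded f : poly_bounded (cost^~ f).
Proof.
elim: f => /= *; do ?[exact: poly_bounded_const | exact: poly_bounded_id
  | assumption | apply: poly_bounded_add | apply: poly_bounded_mul].
Qed.

(** * Execution of deterministic commands *)

(** Stated relative to any continuation k; the tree only gains T [Step] nodes, so such a command
    does not branch. *)
Definition runs (c : cmd) (T : nat) (st st' : store) :=
  forall k t, search_tree k st' t -> search_tree (c :: k) st (iter T Step t).

Definition reaches (T : nat) (c : cmd) (st : store) (Q : store -> Prop) :=
  exists T' st', [/\ T' <= T, Q st' & runs c T' st st'].

Lemma reaches_leq T1 T2 c st Q : T1 <= T2 -> reaches T1 c st Q -> reaches T2 c st Q.
Proof. by move=> le12 [T [st' [leT H1 H2]]]; exists T, st'; split=> //; lia. Qed.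

Lemma reaches_skip st (Q : store -> Prop) : Q st -> reaches 1 Skip st Q.
Proof. by move=> HQ; exists 1, st; split=> // k t H; apply: STSkip. Qed.

Lemma reaches_assign x e st (Q : store -> Prop) :
  Q (update st x (eval st e)) -> reaches 1 (Assign x e) st Q.
Proof. by move=> HQ; exists 1, (update st x (eval st e)); split=> // k t H; apply: STAssign. Qed.

Lemma reaches_seq T1 T2 c1 c2 st Q1 Q :
  reaches T1 c1 st Q1 -> (forall st1, Q1 st1 -> reaches T2 c2 st1 Q) ->
  reaches (T1 + T2).+1 (c1 ;; c2) st Q.
Proof.
move=> [U1 [st1 [le1 HQ1 R1]]] /(_ _ HQ1) [U2 [st2 [le2 HQ R2]]].
exists (U1 + U2).+1, st2; split=> //; first by rewrite ltnS leq_add.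
by move=> k t H; rewrite iterS iterD; apply/STSeq/R1/R2.
Qed.

Lemma reaches_assign_seq T x e c st Q :
  reaches T c (update st x (eval st e)) Q ->
  reaches T.+2 (Assign x e ;; c) st Q.
Proof.
move=> H; apply: (@reaches_seq 1 T _ _ _ (fun st1 => st1 = update st x (eval st e))).
  exact: reaches_assign.
by move=> st1 ->.
Qed.

Lemma reaches_if T e c1 c2 st Q :
  reaches T (if truthy (eval st e) then c1 else c2) st Q ->
  reaches T.+1 (If e c1 c2) st Q.
Proof.
move=> [U [st1 [le1 HQ1 R1]]]; exists U.+1, st1; split=> // k t H.
by apply: STIf; have := R1 _ _ H; case: ifP.
Qed.

Lemma reaches_while T e c (J : nat -> store -> Prop) k st :
  (forall j st1, J j st1 -> truthy (eval st1 e) = (0 < j)) ->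
  (forall j st1, J j.+1 st1 -> reaches T c st1 (J j)) ->
  J k st -> reaches (k * T.+1).+1 (While e c) st (J 0).
Proof.
move=> He Hc; elim: k st => [|k IH] st HJ.
  exists 1, st; split=> // k t H; apply: STWhile.
  by have := He _ _ HJ; case: (truthy _).
have [U1 [st1 [le1 /IH [U2 [st2 [le2 HJ2 R2]]] R1]]] := Hc _ _ HJ.
exists (U1 + U2).+1, st2; split=> //; first by rewrite mulSn; lia.
move=> kk t H; rewrite iterS iterD; apply: STWhile; rewrite (He _ _ HJ) /=.
exact/R1/R2.
Qed.

Lemma update_eq st x d : update st x d x = d.
Proof. by rewrite /update eqxx. Qed.

Lemma update_neq st x d y : y != x -> update st x d y = st y.
Proof. by rewrite /update => /negbTE ->. Qed.

Ltac upd := repeat first [rewrite update_eq | rewrite update_neq; [|lia]].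

(** Induction on f for all r at once, since subterms run in r itself or in scratch variables above
    it. The clock, variable 1, lies below r and is intact at every recursive call. *)
Lemma comp_reaches N f r st : 1 < r -> size (unlist (st 1)) = N ->
  reaches (cost N f) (comp f r) st
    (fun st' => (forall y, y < r -> st' y = st y) /\ st' r = den N f (st r)).
Proof.
elim: f r st => [||g IHg h IHh|g IHg|g IHg|g IHg h IHh|c IHc g IHg h IHh
  |l IHl i IHi b IHb] r st r_gt1 Hclk /=.
- exact: reaches_skip.
- by apply: reaches_assign; split=> [y lt_yr|] /=; upd.
- apply: (@reaches_leq (cost N g + (cost N h + 1).+1.+2).+1.+2); first by lia.
  apply: reaches_assign_seq; apply: reaches_seq.
    by apply: IHg; [lia | upd].
  move=> st1 /= [pres1 eq1]; apply: reaches_assign_seq; apply: reaches_seq.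
    by apply: IHh; [lia | upd; rewrite pres1; [upd|lia]].
  move=> st2 /= [pres2 eq2]; apply: reaches_assign; split=> [y lt_yr|] /=.
    by upd; rewrite pres2 ?(ltn_trans lt_yr) //; upd; rewrite pres1; [upd|lia].
  upd; rewrite eq2 pres2; last by lia.
  by upd; rewrite eq1 pres1; [upd|lia].
- apply: (@reaches_leq (cost N g + 1).+1); first by lia.
  apply: reaches_seq; first exact: IHg.
  move=> st1 /= [pres1 eq1]; apply: reaches_assign; split=> [y lt_yr|] /=; upd.
    exact: pres1.
  by rewrite eq1.
- apply: (@reaches_leq (cost N g + 1).+1); first by lia.
  apply: reaches_seq; first exact: IHg.
  move=> st1 /= [pres1 eq1]; apply: reaches_assign; split=> [y lt_yr|] /=; upd.
    exact: pres1.
  by rewrite eq1.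
- apply: (@reaches_leq (cost N h + cost N g).+1); first by lia.
  apply: reaches_seq; first exact: IHh.
  move=> st1 /= [pres1 eq1].
  have [|T [st2 [leT [pres2 eq2] R2]]] := IHg r st1 r_gt1; first by rewrite pres1.
  exists T, st2; split=> //; split=> [y lt_yr|]; last by rewrite eq2 eq1.
  by rewrite pres2 ?pres1.
- apply: (@reaches_leq (cost N c + (maxn (cost N g) (cost N h)).+1).+1.+2); first by lia.
  apply: reaches_assign_seq; apply: reaches_seq.
    by apply: IHc; [lia | upd].
  move=> st1 /= [pres1 eq1].
  have e0 : st1 r = st r by rewrite pres1; [upd|lia].
  have eqc : st1 r.+1 = den N c (st r) by rewrite eq1; upd.
  have pres y : y < r -> st1 y = st y by move=> lt_yr; rewrite pres1; [upd|lia].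
  apply: reaches_if => /=; rewrite eqc.
  case: ifP => _.
    apply: (@reaches_leq (cost N g)); first by lia.
    have [|T [st2 [leT [pres2 eq2] R2]]] := IHg r st1 r_gt1; first by rewrite pres.
    exists T, st2; split=> //; split=> [y lt_yr|]; last by rewrite eq2 e0.
    by rewrite pres2 ?pres.
  apply: (@reaches_leq (cost N h)); first by lia.
  have [|T [st2 [leT [pres2 eq2] R2]]] := IHh r st1 r_gt1; first by rewrite pres.
  exists T, st2; split=> //; split=> [y lt_yr|]; last by rewrite eq2 e0.
  by rewrite pres2 ?pres.
- apply: (@reaches_leq (cost N l + (cost N i + ((N * (cost N b + 20)).+1 + 1).+1.+2).+1.+2).+1.+2); first by lia.
  apply: reaches_assign_seq; apply: reaches_seq.
    by apply: IHl; [lia | upd].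
  move=> st1 /= [pres1 eq1]; apply: reaches_assign_seq; apply: reaches_seq.
    by apply: IHi; [lia | upd; rewrite pres1; [upd|lia]].
  move=> st2 /= [pres2 eq2]; apply: reaches_assign_seq => /=.
  have H21 : st2 1 = st 1 by rewrite pres2; [upd; rewrite pres1; [upd|lia]|lia].
  pose step acc e := den N b (Cons (st r) (Cons e acc)).
  (* With j cells left on the clock, folding at most j more entries into the current accumulator
     gives the final value; once the list is empty, the remaining rounds only consume the clock. *)
  pose J j st3 := [/\ forall y, y <= r -> st3 y = st y,
    size (unlist (st3 r.+3)) = j &
    foldl step (st3 r.+2) (take j (unlist (st3 r.+1)))
      = den N (FFold l i b) (st r)].
  apply: (@reaches_seq _ _ _ _ _ (J 0)); last first.
    move=> st3 [presJ _ eqJ]; apply: reaches_assign; split=> [y lt_yr|] /=; upd.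
      by rewrite presJ // ltnW.
    by rewrite take0 /= in eqJ.
  apply: (@reaches_leq (N * (cost N b + 19).+1).+1); first by lia.
  apply: (@reaches_while _ _ _ J).
  + by move=> j st3 [_ <- _] /=; case: (st3 r.+3).
  + move=> j st3 [presJ clkJ eqJ].
    apply: (@reaches_leq ((cost N b + (1 + 1).+1).+1.+2).+1.+2); first by lia.
    apply: reaches_assign_seq; apply: reaches_if => /=; upd.
    case E1: (st3 r.+1) => [|d1 d2] /=.
      apply: (@reaches_leq 1); first by lia.
      apply: reaches_skip; split=> [y le_yr||].
      * by upd; rewrite presJ.
      * by upd; move: clkJ; case: (st3 r.+3) => //= a a' [].
      * by upd; move: eqJ; rewrite E1 /=.
    apply: reaches_assign_seq => /=; apply: reaches_seq.
      by apply: IHb; [lia | upd; rewrite presJ //; lia].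
    move=> st4 /= [pres4 eq4]; apply: reaches_assign_seq => /=.
    apply: reaches_assign; split=> [y le_yr||] /=.
    * by upd; rewrite pres4; [upd; rewrite presJ|lia].
    * upd; rewrite pres4; last by lia.
      by upd; move: clkJ; case: (st3 r.+3) => //= a a' [].
    * upd; rewrite eq4 pres4; last by lia.
      by upd; move: eqJ; rewrite E1 /= (presJ r).
  + split=> [y le_yr||]; upd.
    * by rewrite pres2; [upd; rewrite pres1; [upd|lia]|lia].
    * by rewrite H21.
    * rewrite eq2 pres2; last by lia.
      by upd; rewrite eq1 pres1; [upd|lia].
Qed.

(** * Functions on vertices, edges and states *)

Definition dnat (n : nat) : data := iter n (Cons Nil) Nil.
Definition dvs : seq nat -> data := encode_seq dnat.
Definition dfam : seq (seq nat) -> data := encode_seq dvs.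

Definition state := (seq nat * seq (seq nat))%type.
Definition dstate (S : state) : data := Cons (dvs S.1) (dfam S.2).
Definition dstates : seq state -> data := encode_seq dstate.

(** Folds stop after N rounds, so lists are processed completely if their length is at most N, and
    vertices, being unary numbers, if their value is. *)
Definition vs_ok (N : nat) (e : seq nat) := (size e <= N) && all (leq^~ N) e.
Definition fam_ok (N : nat) (E : seq (seq nat)) := (size E <= N) && all (vs_ok N) E.

Lemma vs_ok_size N e : vs_ok N e -> size e <= N. Proof. by case/andP. Qed.
Lemma fam_ok_size N E : fam_ok N E -> size E <= N. Proof. by case/andP. Qed.

Lemma vs_ok_le N e v : vs_ok N e -> v \in e -> v <= N.
Proof. by case/andP=> _ /allP; apply. Qed.

Lemma fam_ok_vs N E e : fam_ok N E -> e \in E -> vs_ok N e.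
Proof. by case/andP=> _ /allP; apply. Qed.

(** * Booleans and folds over lists *)

Definition FTrue := FCons FNil FNil.
Definition FNot f := FIf f FNil FTrue.
Definition FAnd f g := FIf f g FNil.
(* The body of a fold over an input x receives [Cons x (Cons e acc)]. *)
Definition FCtx := FHd FId.
Definition FElt := FHd (FTl FId).
Definition FAcc := FTl (FTl FId).
Definition FLet f g := FComp g (FCons f FId).

Lemma truthy_bool b : truthy (encode_bool b) = b. Proof. by case: b. Qed.

Lemma truthy_seq (T : Type) (f : T -> data) s :
  truthy (encode_seq f s) = (0 < size s).
Proof. by case: s. Qed.

Lemma den_not N f x b :
  den N f x = encode_bool b -> den N (FNot f) x = encode_bool (~~ b).
Proof. by move=> /= ->; case: b. Qed.

Lemma den_and N f g x b c :
  den N f x = encode_bool b -> (b -> den N g x = encode_bool c) ->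
  den N (FAnd f g) x = encode_bool (b && c).
Proof. by move=> /= ->; case: b => //= ->. Qed.

Definition FHas l p := FFold l FNil (FIf p FTrue FAcc).

Lemma den_has (T : eqType) N l p x (enc : T -> data) (s : seq T) (P : pred T) :
  den N l x = encode_seq enc s -> size s <= N ->
  (forall y acc, y \in s ->
     den N p (Cons x (Cons (enc y) acc)) = encode_bool (P y)) ->
  den N (FHas l p) x = encode_bool (has P s).
Proof.
move=> /= -> size_s Hp; rewrite unlist_encode_seq take_oversize ?size_map //.
set F := fun acc e => _; rewrite -[has P s]orbF.
suff {size_s}: forall b, foldl F (encode_bool b) (map enc s) = encode_bool (has P s || b).
  by move/(_ false).
elim: s Hp => [//|y s IH] Hp b /=.
rewrite {2}/F Hp ?mem_head // truthy_bool.
have -> : (if P y then Cons Nil Nil else encode_bool b) = encode_bool (P y || b).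
  by case: (P y).
rewrite IH; last by move=> z acc zs; apply: Hp; rewrite inE zs orbT.
by congr encode_bool; rewrite orbCA orbA.
Qed.

(** Pushing onto the accumulator reverses the list, hence the [rev] in the functions on states
    below. *)
Definition FFilterMap l p g := FFold l FNil (FIf p (FCons g FAcc) FAcc).

Lemma den_filter_map (T : eqType) (T' : Type) N l p g x (enc : T -> data)
    (enc' : T' -> data) (s : seq T) (P : pred T) (G : T -> T') :
  den N l x = encode_seq enc s -> size s <= N ->
  (forall y acc, y \in s ->
     den N p (Cons x (Cons (enc y) acc)) = encode_bool (P y)) ->
  (forall y acc, y \in s -> P y ->
     den N g (Cons x (Cons (enc y) acc)) = enc' (G y)) ->
  den N (FFilterMap l p g) x = encode_seq enc' (rev [seq G y | y <- s & P y]).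
Proof.
move=> /= -> size_s Hp Hg; rewrite unlist_encode_seq take_oversize ?size_map //.
set F := fun acc e => _; rewrite /rev.
suff {size_s}: forall r, foldl F (encode_seq enc' r) (map enc s) =
    encode_seq enc' (catrev [seq G y | y <- s & P y] r).
  by move/(_ [::]).
elim: s Hp Hg => [//|y s IH] Hp Hg r /=.
rewrite {2}/F Hp ?mem_head // truthy_bool.
have Hp' z acc : z \in s -> den N p (Cons x (Cons (enc z) acc)) = encode_bool (P z).
  by move=> zs; apply: Hp; rewrite inE zs orbT.
have Hg' z acc : z \in s -> P z -> den N g (Cons x (Cons (enc z) acc)) = enc' (G z).
  by move=> zs; apply: Hg; rewrite inE zs orbT.
case: ifP => Py; last exact: IH.
by rewrite Hg ?mem_head // -(IH Hp' Hg' (G y :: r)).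
Qed.

Definition FFilter l p := FFilterMap l p FElt.

Lemma den_filter (T : eqType) N l p x (enc : T -> data) (s : seq T) (P : pred T) :
  den N l x = encode_seq enc s -> size s <= N ->
  (forall y acc, y \in s ->
     den N p (Cons x (Cons (enc y) acc)) = encode_bool (P y)) ->
  den N (FFilter l p) x = encode_seq enc (rev [seq y <- s | P y]).
Proof.
move=> H1 H2 H3; rewrite -[X in rev X]map_id; exact: (den_filter_map H1 H2 H3).
Qed.

Definition FTls k f := iter k FTl f.

Lemma den_tls (T : Type) N k f x (enc : T -> data) s :
  den N f x = encode_seq enc s -> den N (FTls k f) x = encode_seq enc (drop k s).
Proof.
move=> Hf; elim: k => [|k IH] /=; first by rewrite drop0.
rewrite IH -add1n -drop_drop.
by case: (drop k s) => //= a t; rewrite drop0.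
Qed.

(** The threshold k is a constant of the program, so the comparison is unrolled into k tails. *)
Definition FGt k f := FIf (FTls k f) FTrue FNil.

Lemma den_gt (T : Type) N k f x (enc : T -> data) s :
  den N f x = encode_seq enc s -> den N (FGt k f) x = encode_bool (k < size s).
Proof.
by move=> Hf /=; rewrite (den_tls k Hf) truthy_seq size_drop subn_gt0; case: ifP.
Qed.

Fixpoint FTake k :=
  if k is k'.+1 then FIf FId (FCons (FHd FId) (FComp (FTake k') (FTl FId))) FNil
  else FNil.

Lemma den_take (T : Type) N k (enc : T -> data) s :
  den N (FTake k) (encode_seq enc s) = encode_seq enc (take k s).
Proof. by elim: k s => [|k IH] [|y s] //=; rewrite IH. Qed.

Definition FCatrev := FFold (FHd FId) (FTl FId) (FCons FElt FAcc).

Lemma den_catrev (T : Type) N (enc : T -> data) s r : size s <= N ->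
  den N FCatrev (Cons (encode_seq enc s) (encode_seq enc r)) =
  encode_seq enc (catrev s r).
Proof.
move=> size_s /=; rewrite unlist_encode_seq take_oversize ?size_map //.
by elim: s r {size_s} => //= y s IH r; rewrite -IH.
Qed.
(* Opaque, so that [/=] does not evaluate past the named functions. *)
#[local] Opaque FCatrev.

(** * Unary numbers and sets of vertices *)

(** Takes as many tails of the first component as the second one counts: truncated subtraction on
    numbers, but also access to a position of a list. *)
Definition FSub := FFold (FTl FId) (FHd FId) (FTl FAcc).

Lemma unlist_dnat n : unlist (dnat n) = nseq n Nil.
Proof. by elim: n => //= n ->. Qed.

Lemma den_sub N a b : b <= N -> den N FSub (Cons a (dnat b)) = iter b tl a.
Proof.
move=> leb /=; rewrite unlist_dnat take_oversize ?size_nseq //.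
by elim: b a {leb} => //= b IH a; rewrite IH -iterSr.
Qed.
#[local] Opaque FSub.

Lemma iter_tl_dnat a b : iter b tl (dnat a) = dnat (a - b).
Proof. by elim: b => [|b IH] /=; rewrite ?subn0 // IH subnS; case: (a - b). Qed.

Lemma truthy_dnat n : truthy (dnat n) = (0 < n). Proof. by case: n. Qed.

Definition FEq := FIf FSub FNil (FNot (FComp FSub (FCons (FTl FId) (FHd FId)))).

Lemma den_eq N a b : a <= N -> b <= N ->
  den N FEq (Cons (dnat a) (dnat b)) = encode_bool (a == b).
Proof.
move=> lea leb /=; rewrite !den_sub // !iter_tl_dnat !truthy_dnat !subn_gt0.
by case: ltngtP.
Qed.
#[local] Opaque FEq.

Definition FMem := FHas (FTl FId) (FComp FEq (FCons (FHd FCtx) FElt)).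

Lemma den_mem N v e : v <= N -> vs_ok N e ->
  den N FMem (Cons (dnat v) (dvs e)) = encode_bool (v \in e).
Proof.
move=> lev oke; rewrite -has_pred1.
apply: (@den_has _ _ _ _ _ dnat e) => // [|y acc ye]; first exact: vs_ok_size.
by rewrite /= den_eq // 1?(vs_ok_le oke) // eq_sym.
Qed.
#[local] Opaque FMem.

Definition FMeets := FHas (FHd FId) (FComp FMem (FCons FElt (FTl FCtx))).

Lemma den_meets N i e : vs_ok N i -> vs_ok N e ->
  den N FMeets (Cons (dvs i) (dvs e)) = encode_bool (has (mem e) i).
Proof.
move=> oki oke; apply: (@den_has _ _ _ _ _ dnat i) => // [|y acc yi]; first exact: vs_ok_size.
by rewrite /= den_mem // (vs_ok_le oki).
Qed.
#[local] Opaque FMeets.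

Definition diff (e o : seq nat) : seq nat := rev [seq x <- e | x \notin o].

Definition FDiff := FFilter (FHd FId) (FNot (FComp FMem (FCons FElt (FTl FCtx)))).

Lemma den_diff N e o : vs_ok N e -> vs_ok N o ->
  den N FDiff (Cons (dvs e) (dvs o)) = dvs (diff e o).
Proof.
move=> oke oko; apply: (@den_filter _ _ _ _ _ dnat e) => // [|y acc ye]; first exact: vs_ok_size.
by apply: den_not; rewrite /= den_mem // (vs_ok_le oke).
Qed.
#[local] Opaque FDiff.

(** * Programs for the branching rules *)

(** The vertices of i are chosen and those of o excluded. Edges met by i are now hit and disappear,
    so chosen vertices need not be removed from the others. *)
Definition assign (i o : seq nat) (S : state) : state :=
  (catrev i S.1, rev [seq diff e o | e <- S.2 & ~~ has (mem e) i]).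

Definition FAssignFam :=
  FFilterMap (FTl (FTl FId))
    (FNot (FComp FMeets (FCons (FHd (FHd FCtx)) FElt)))
    (FComp FDiff (FCons FElt (FTl (FHd FCtx)))).

Lemma den_assign_fam N i o S : vs_ok N i -> vs_ok N o -> fam_ok N S.2 ->
  den N FAssignFam (Cons (Cons (dvs i) (dvs o)) (dstate S)) = dfam (assign i o S).2.
Proof.
move=> oki oko okE.
apply: (@den_filter_map _ _ _ _ _ _ _ dvs dvs S.2) => [||y acc yE|y acc yE _] //.
- exact: fam_ok_size.
- by apply: den_not; rewrite /= den_meets // (fam_ok_vs okE).
- by rewrite /= den_diff // (fam_ok_vs okE).
Qed.
#[local] Opaque FAssignFam.

Definition FAssign :=
  FCons (FComp FCatrev (FCons (FHd (FHd FId)) (FHd (FTl FId)))) FAssignFam.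

Lemma den_assign N i o S : vs_ok N i -> vs_ok N o -> fam_ok N S.2 ->
  den N FAssign (Cons (Cons (dvs i) (dvs o)) (dstate S)) = dstate (assign i o S).
Proof.
move=> oki oko okE; rewrite /= den_assign_fam //; congr Cons.
by apply: (den_catrev dnat); apply: vs_ok_size.
Qed.
#[local] Opaque FAssign.

(** In the branch of v, the first vertex of the edge in T, the vertices [pre] passed over are
    excluded. An empty edge has no branch: a state in which it is selected dies. *)
Fixpoint opts (pre e : seq nat) (S : state) : seq state :=
  if e is v :: e' then assign [:: v] pre S :: opts (v :: pre) e' S else [::].

(** The accumulator pairs the vertices passed over with the states found; the outer [FTl] forgets
    the former. *)
Definition FOpts :=
  FTl (FFold (FHd FId) (FCons FNil FNil)
        (FCons (FCons FElt (FHd FAcc))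
           (FCons (FComp FAssign
                     (FCons (FCons (FCons FElt FNil) (FHd FAcc)) (FTl FCtx)))
                  (FTl FAcc)))).

Lemma den_opts N e S : vs_ok N e -> fam_ok N S.2 ->
  den N FOpts (Cons (dvs e) (dstate S)) = dstates (rev (opts [::] e S)).
Proof.
move=> oke okE /=; rewrite unlist_encode_seq take_oversize ?size_map ?vs_ok_size //.
have [N0|N_gt0] := posnP N.
  by case: e oke => //= v e; rewrite /vs_ok N0.
set F := fun acc e => _.
suff H : forall pre r, vs_ok N (rev e ++ pre) ->
    tl (foldl F (Cons (dvs pre) (dstates r)) (map dnat e)) =
    dstates (catrev (opts pre e S) r).
  by apply: (H [::] [::]); rewrite cats0 /vs_ok size_rev all_rev.
elim: e {oke} => [//|v e IH] pre r.
rewrite rev_cons cat_rcons => ok_pre.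
have okv : vs_ok N (v :: pre).
  by move: ok_pre; rewrite /vs_ok size_cat all_cat /=; lia.
have okpre : vs_ok N pre by move: okv; rewrite /vs_ok /=; lia.
have okv1 : vs_ok N [:: v] by move: okv; rewrite /vs_ok /=; lia.
by rewrite /= -IH //= {2}/F /= (@den_assign N [:: v] pre S).
Qed.
#[local] Opaque FOpts.

Lemma vs_ok_sub N e e' : size e' <= size e -> {subset e' <= e} ->
  vs_ok N e -> vs_ok N e'.
Proof.
move=> le_e sub_e /andP [size_e /allP all_e]; apply/andP; split; first exact: leq_trans size_e.
by apply/allP => x /sub_e /all_e.
Qed.

Lemma mem_diff x e o : (x \in diff e o) = (x \in e) && (x \notin o).
Proof. by rewrite mem_rev mem_filter andbC. Qed.

Lemma vs_ok_diff N e o : vs_ok N e -> vs_ok N (diff e o).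
Proof.
apply: vs_ok_sub => [|x]; first by rewrite size_rev size_filter count_size.
by rewrite mem_diff => /andP [].
Qed.

Lemma vs_ok_take N k e : vs_ok N e -> vs_ok N (take k e).
Proof. by apply: vs_ok_sub => [|x]; [rewrite size_take_min geq_minr | apply: mem_take]. Qed.

Lemma vs_ok1 N e v : vs_ok N e -> v \in e -> vs_ok N [:: v].
Proof.
case: e => // w e oke vE; rewrite /vs_ok /= (vs_ok_le oke vE) !andbT.
by case/andP: oke => /=; lia.
Qed.

Definition FSmall d := FFilter (FTl FId) (FNot (FGt d FElt)).

Lemma den_small N d S : fam_ok N S.2 ->
  den N (FSmall d) (dstate S) = dfam (rev [seq e <- S.2 | size e <= d]).
Proof.
move=> okE; apply: (@den_filter _ _ _ _ _ dvs S.2) => [||e acc eE] //.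
  exact: fam_ok_size.
by rewrite leqNgt; apply: den_not; apply: (@den_gt _ _ _ _ _ dnat).
Qed.
#[local] Opaque FSmall.

Definition FBig k := FFilter (FTl FId) (FGt k FElt).

Lemma den_big N k S : fam_ok N S.2 ->
  den N (FBig k) (dstate S) = dfam (rev [seq e <- S.2 | k < size e]).
Proof.
move=> okE; apply: (@den_filter _ _ _ _ _ dvs S.2) => [||e acc eE] //.
  exact: fam_ok_size.
by apply: (@den_gt _ _ _ _ _ dnat).
Qed.
#[local] Opaque FBig.

(** Either T meets the first k vertices of e, which is cut down to them while the other big edges
    [bg] are kept, or T avoids them all. *)
Definition cut_big k (e : seq nat) (bg : seq (seq nat)) (S : state) : seq state :=
  [:: (S.1, take k e :: catrev bg (rev [seq e <- S.2 | size e <= k]));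
      assign [::] (take k e) S].

Definition FCutBig k :=
  FCons (FCons (FHd (FTl FId))
           (FCons (FComp (FTake k) (FHd (FHd FId)))
              (FComp FCatrev (FCons (FTl (FHd FId)) (FComp (FSmall k) (FTl FId))))))
    (FCons (FComp FAssign
              (FCons (FCons FNil (FComp (FTake k) (FHd (FHd FId)))) (FTl FId)))
       FNil).

Lemma den_cut_big N k e bg S : vs_ok N e -> size bg <= N -> fam_ok N S.2 ->
  den N (FCutBig k) (Cons (dfam (e :: bg)) (dstate S)) = dstates (cut_big k e bg S).
Proof.
move=> oke okbg okE; rewrite /= den_small // (den_catrev dvs) //.
by rewrite (den_take N k dnat) (@den_assign N [::]) // vs_ok_take.
Qed.
#[local] Opaque FCutBig.

Definition low c (E : seq (seq nat)) (v : nat) := count (fun e => v \in e) E <= c.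

Definition FLow c :=
  FNot (FGt c (FFilter (FTl FId) (FComp FMem (FCons (FHd FCtx) FElt)))).

Lemma den_low N c v E : v <= N -> fam_ok N E ->
  den N (FLow c) (Cons (dnat v) (dfam E)) = encode_bool (low c E v).
Proof.
move=> lev okE; rewrite /low leqNgt -size_filter -size_rev; apply: den_not.
apply: (@den_gt _ _ _ _ _ dvs).
apply: (@den_filter _ _ _ _ _ dvs E) => [||e acc eE] //; first exact: fam_ok_size.
by rewrite /= den_mem // (fam_ok_vs okE).
Qed.
#[local] Opaque FLow.

Definition FLowEdges c :=
  FFilter (FTl FId)
    (FHas FElt (FComp (FLow c) (FCons FElt (FTl (FHd FCtx))))).

Lemma den_low_edges N c S : fam_ok N S.2 ->
  den N (FLowEdges c) (dstate S) = dfam (rev [seq e <- S.2 | has (low c S.2) e]).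
Proof.
move=> okE; apply: (@den_filter _ _ _ _ _ dvs S.2) => [||e acc eE] //.
  exact: fam_ok_size.
have oke := fam_ok_vs okE eE.
apply: (@den_has _ _ _ _ _ dnat e) => [||v acc' ve] //; first exact: vs_ok_size.
by rewrite /= den_low // (vs_ok_le oke).
Qed.
#[local] Opaque FLowEdges.

Definition FLowVs c :=
  FFilter (FHd FId) (FComp (FLow c) (FCons FElt (FTl (FTl FCtx)))).

Lemma den_low_vs N c e S : vs_ok N e -> fam_ok N S.2 ->
  den N (FLowVs c) (Cons (dvs e) (dstate S)) = dvs (rev [seq v <- e | low c S.2 v]).
Proof.
move=> oke okE; apply: (@den_filter _ _ _ _ _ dnat e) => [||v acc ve] //.
  exact: vs_ok_size.
by rewrite /= den_low // (vs_ok_le oke).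
Qed.
#[local] Opaque FLowVs.

Definition guess_private v (S : state) : seq state :=
  rev [seq assign [:: v] (diff e [:: v]) S | e <- S.2 & v \in e].

Definition FGuessPrivate :=
  FFilterMap (FTl (FTl FId)) (FComp FMem (FCons (FHd FCtx) FElt))
    (FComp FAssign
       (FCons (FCons (FCons (FHd FCtx) FNil)
                 (FComp FDiff (FCons FElt (FCons (FHd FCtx) FNil))))
          (FTl FCtx))).

Lemma den_guess_private N v S : vs_ok N [:: v] -> fam_ok N S.2 ->
  den N FGuessPrivate (Cons (dnat v) (dstate S)) = dstates (guess_private v S).
Proof.
move=> okv okE; have lev : v <= N by apply: vs_ok_le okv _; rewrite mem_head.
apply: (@den_filter_map _ _ _ _ _ _ _ dvs dstate S.2) => [||e acc eE|e acc eE ve] //.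
- exact: fam_ok_size.
- by rewrite /= den_mem // (fam_ok_vs okE).
- have oke := fam_ok_vs okE eE.
  rewrite /= (@den_diff N e [:: v]) // (@den_assign N [:: v]) //.
  exact: vs_ok_diff.
Qed.
#[local] Opaque FGuessPrivate.

Definition exclude_or_private v (S : state) : seq state :=
  assign [::] [:: v] S :: guess_private v S.

Definition FExcludeOrPrivate :=
  FCons (FComp FAssign (FCons (FCons FNil (FCons (FHd FId) FNil)) (FTl FId)))
    FGuessPrivate.

Lemma den_exclude_or_private N v S : vs_ok N [:: v] -> fam_ok N S.2 ->
  den N FExcludeOrPrivate (Cons (dnat v) (dstate S)) =
  dstates (exclude_or_private v S).
Proof.
by move=> okv okE; rewrite /= den_guess_private // (@den_assign N [::] [:: v]).
Qed.
#[local] Opaque FExcludeOrPrivate.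

Definition include_or_exclude v (S : state) : seq state :=
  [:: assign [:: v] [::] S; assign [::] [:: v] S].

Definition FIncludeOrExclude :=
  FCons (FComp FAssign (FCons (FCons (FCons (FHd FId) FNil) FNil) (FTl FId)))
    (FCons (FComp FAssign (FCons (FCons FNil (FCons (FHd FId) FNil)) (FTl FId)))
       FNil).

Lemma den_include_or_exclude N v S : vs_ok N [:: v] -> fam_ok N S.2 ->
  den N FIncludeOrExclude (Cons (dnat v) (dstate S)) =
  dstates (include_or_exclude v S).
Proof.
move=> okv okE.
by rewrite /= (@den_assign N [:: v] [::]) // (@den_assign N [::] [:: v]).
Qed.
#[local] Opaque FIncludeOrExclude.

Lemma mem_revfilter (p : pred (seq nat)) (E : seq (seq nat)) e l :
  rev [seq e <- E | p e] = e :: l -> e \in E /\ p e.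
Proof.
move=> eq_l; have : e \in rev [seq e <- E | p e] by rewrite eq_l mem_head.
by rewrite mem_rev mem_filter => /andP [].
Qed.

Lemma revfilter_nil (p : pred (seq nat)) (E : seq (seq nat)) e :
  rev [seq e <- E | p e] = [::] -> e \in E -> ~~ p e.
Proof.
move=> eq_l eE; apply/negP => pe.
by have := mem_rev [seq e <- E | p e] e; rewrite eq_l mem_filter pe eE.
Qed.

(** Later rules rely on the failure of earlier ones. If an edge is left, the default values of
    [head] are never reached. *)
Definition children (d k c : nat) (S : state) : seq state :=
  if rev [seq e <- S.2 | size e <= d] is e :: _ then rev (opts [::] e S)
  else if rev [seq e <- S.2 | k < size e] is e :: bg then cut_big k e bg S
  else if rev [seq e <- S.2 | has (low c S.2) e] is e :: _ then
    exclude_or_private (head 0 (rev [seq v <- e | low c S.2 v])) S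
  else include_or_exclude (head 0 (head [::] S.2)) S.

(** An empty list is [Nil], so the candidates bound by [FLet] also serve as the test of [FIf]; [FTl]
    drops them before the next rule. *)
Definition FChildren d k c :=
  FLet (FSmall d)
    (FIf (FHd FId) (FComp FOpts (FCons (FHd (FHd FId)) (FTl FId)))
    (FComp (FLet (FBig k) (FIf (FHd FId) (FCutBig k)
    (FComp (FLet (FLowEdges c)
       (FIf (FHd FId)
          (FComp FExcludeOrPrivate
             (FCons (FHd (FComp (FLowVs c) (FCons (FHd (FHd FId)) (FTl FId))))
                    (FTl FId)))
          (FComp FIncludeOrExclude
             (FCons (FHd (FHd (FTl (FTl FId)))) (FTl FId)))))
       (FTl FId)))) (FTl FId))).

Lemma den_children N d k c S : fam_ok N S.2 -> S.2 != [::] ->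
  den N (FChildren d k c) (dstate S) = dstates (children d k c S).
Proof.
move=> okE nzE.
rewrite /children /= den_small //.
case Esm: (rev [seq e <- S.2 | size e <= d]) => [|e l].
  rewrite /= den_big //.
  case Ebg: (rev [seq e <- S.2 | k < size e]) => [|e l].
    rewrite /= den_low_edges //.
    case Elo: (rev [seq e <- S.2 | has (low c S.2) e]) => [|e l].
      case ES: S.2 nzE => [//|e E] _ /=.
      have eS : e \in S.2 by rewrite ES mem_head.
      have oke := fam_ok_vs okE eS.
      case: e {ES} eS oke => [|v e] eS oke.
        (* An empty edge has size at most d and would have been found by the first test. *)
        by move: (mem_rev [seq e <- S.2 | size e <= d] [::]);
          rewrite Esm mem_filter eS.
      rewrite /= den_include_or_exclude //; apply: vs_ok1 oke _; exact: mem_head.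
    have [eS lo] := mem_revfilter Elo; have oke := fam_ok_vs okE eS.
    rewrite /= den_low_vs //.
    case Ev: (rev [seq v <- e | low c S.2 v]) => [|v r].
      by move: lo; rewrite has_filter -size_eq0 -size_rev Ev.
    have ve : v \in e.
      have : v \in rev [seq v <- e | low c S.2 v] by rewrite Ev mem_head.
      by rewrite mem_rev mem_filter => /andP [].
    rewrite /= den_exclude_or_private //; exact: vs_ok1 oke ve.
  have [eS _] := mem_revfilter Ebg; rewrite -[LHS]/(den N (FCutBig k) _).
  rewrite den_cut_big //; first exact: fam_ok_vs okE eS.
  have : size (e :: l) <= size S.2 by rewrite -Ebg size_rev size_filter count_size.
  by have := fam_ok_size okE; rewrite /=; lia.
have [eS _] := mem_revfilter Esm.
by rewrite /= den_opts //; apply: fam_ok_vs okE eS.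
Qed.
#[local] Opaque FChildren.

(** * Test and output at a leaf *)

Definition FAll l p := FNot (FHas l (FNot p)).

Lemma den_all (T : eqType) N l p x (enc : T -> data) (s : seq T) (P : pred T) :
  den N l x = encode_seq enc s -> size s <= N ->
  (forall y acc, y \in s ->
     den N p (Cons x (Cons (enc y) acc)) = encode_bool (P y)) ->
  den N (FAll l p) x = encode_bool (all P s).
Proof.
move=> Hl size_s Hp; rewrite -[all P s]negbK -has_predC; apply: den_not.
apply: (den_has Hl) => // y acc ys; apply: den_not; exact: Hp.
Qed.

(* The accumulator is here a pair whose first component counts the iterations. *)
Definition FIdx := FHd FAcc.

Definition FIdxFilterMap l p g :=
  FTl (FFold l (FCons FNil FNil)
        (FCons (FCons FNil FIdx) (FIf p (FCons g (FTl FAcc)) (FTl FAcc)))).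

Lemma den_idx_filter_map (T : Type) N l p g x (s : seq data) (enc : T -> data)
    (P : pred nat) (G : nat -> T) :
  unlist (den N l x) = s -> size s <= N ->
  (forall j acc, j < size s ->
     den N p (Cons x (Cons (nth Nil s j) (Cons (dnat j) acc))) = encode_bool (P j)) ->
  (forall j acc, j < size s -> P j ->
     den N g (Cons x (Cons (nth Nil s j) (Cons (dnat j) acc))) = enc (G j)) ->
  den N (FIdxFilterMap l p g) x =
  encode_seq enc (rev [seq G j | j <- iota 0 (size s) & P j]).
Proof.
move=> /= -> size_s Hp Hg; rewrite take_oversize //.
set F := fun acc e => _.
suff H : forall q i r, i + size q = size s -> q = drop i s ->
    tl (foldl F (Cons (dnat i) (encode_seq enc r)) q) =
    encode_seq enc (catrev [seq G j | j <- iota i (size q) & P j] r).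
  by apply: (H s 0 [::]); rewrite ?drop0.
elim=> [//|y q IH] i r /= size_q eq_q.
have lt_i : i < size s by lia.
have ey : y = nth Nil s i by rewrite -[i]addn0 -nth_drop -eq_q.
have eq_q' : q = drop i.+1 s by rewrite -add1n -drop_drop -eq_q /= drop0.
rewrite {2}/F /= ey Hp // truthy_bool.
case: ifP => Pi; last by apply: (IH i.+1) => //; lia.
by rewrite Hg //; apply: (IH i.+1 (G i :: r)) => //; lia.
Qed.

Definition FOther :=
  FHas (FHd (FTl (FTl FId)))
    (FAnd (FComp FMem (FCons FElt (FHd FCtx)))
          (FNot (FComp FEq (FCons FElt (FHd (FTl FCtx)))))).

Lemma den_other N e v I d : vs_ok N e -> v <= N -> vs_ok N I ->
  den N FOther (Cons (dvs e) (Cons (dnat v) (Cons (dvs I) d))) =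
  encode_bool (has (fun w => (w \in e) && (w != v)) I).
Proof.
move=> oke lev okI; apply: (@den_has _ _ _ _ _ dnat I) => [||w acc wI] //.
  exact: vs_ok_size.
have lew := vs_ok_le okI wI.
apply: den_and => [|_]; first by rewrite /= den_mem.
by apply: den_not; rewrite /= den_eq.
Qed.
#[local] Opaque FOther.

Definition has_private (I : seq nat) (E : seq (seq nat)) (v : nat) :=
  has (fun e => (v \in e) && ~~ has (fun w => (w \in e) && (w != v)) I) E.

Definition FHasPrivate :=
  FHas (FTl (FTl FId))
    (FAnd (FComp FMem (FCons (FHd FCtx) FElt))
          (FNot (FComp FOther (FCons FElt FCtx)))).

Lemma den_has_private N v I E : v <= N -> vs_ok N I -> fam_ok N E ->
  den N FHasPrivate (Cons (dnat v) (Cons (dvs I) (dfam E))) =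
  encode_bool (has_private I E v).
Proof.
move=> lev okI okE; apply: (@den_has _ _ _ _ _ dvs E) => [||e acc eE] //.
  exact: fam_ok_size.
have oke := fam_ok_vs okE eE.
apply: den_and => [|_]; first by rewrite /= den_mem.
by apply: den_not; rewrite /= den_other.
Qed.
#[local] Opaque FHasPrivate.

(** A hitting set is inclusion-minimal exactly when each of its vertices has a private edge, which
    can be tested in polynomial time. *)
Definition minimal_hitting (I : seq nat) (E : seq (seq nat)) :=
  all (fun e => has (mem e) I) E && all (has_private I E) I.

Definition FMinimalHitting :=
  FAnd (FAll (FTl FId) (FComp FMeets (FCons (FHd FCtx) FElt)))
       (FAll (FHd FId) (FComp FHasPrivate (FCons FElt FCtx))).

Lemma den_minimal_hitting N I E : vs_ok N I -> fam_ok N E ->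
  den N FMinimalHitting (Cons (dvs I) (dfam E)) = encode_bool (minimal_hitting I E).
Proof.
move=> okI okE; apply: den_and => [|_].
  apply: (@den_all _ _ _ _ _ dvs E) => [||e acc eE] //; first exact: fam_ok_size.
  by rewrite /= den_meets // (fam_ok_vs okE).
apply: (@den_all _ _ _ _ _ dnat I) => [||v acc vI] //; first exact: vs_ok_size.
by rewrite /= den_has_private // (vs_ok_le okI).
Qed.
#[local] Opaque FMinimalHitting.

Definition mask_of (I : seq nat) (m : nat) : bitseq := [seq j \in I | j <- iota 0 m].

(** The fold produces the bits in reverse; [FCatrev] onto the empty list restores the order of the
    listing. *)
Definition FMask :=
  FComp FCatrev
    (FCons (FIdxFilterMap (FTl FId) FTrue (FComp FMem (FCons FIdx (FHd FCtx)))) FNil).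

Lemma den_mask N I rows : vs_ok N I -> size (unlist rows) <= N ->
  den N FMask (Cons (dvs I) rows) = encode_bits (mask_of I (size (unlist rows))).
Proof.
move=> okI size_r; rewrite /FMask.
set f := FIdxFilterMap _ _ _; set x := Cons _ _.
have -> : den N (FComp FCatrev (FCons f FNil)) x = den N FCatrev (Cons (den N f x) Nil).
  by [].
have -> : den N f x = encode_seq encode_bool (rev (mask_of I (size (unlist rows)))).
  rewrite /mask_of -[iota _ _ in RHS]filter_predT.
  apply: (@den_idx_filter_map _ _ _ _ _ _ (unlist rows)) => // j acc lt_j _.
  by rewrite /= den_mem //; lia.
rewrite -[Nil]/(encode_seq encode_bool [::]) den_catrev.
  by rewrite -[X in encode_seq _ X]/(rev _) revK.
by rewrite size_rev size_map size_iota.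
Qed.
#[local] Opaque FMask.

(** The first component is [Nil] if no candidate was found and carries I under a [Cons Nil]
    otherwise, which keeps an empty I apart from failure. Candidates are tested, since the branching
    may also produce sets that are not minimal. *)
Definition FAnswer :=
  FIf (FHd FId)
    (FIf (FComp FMinimalHitting (FCons (FTl (FHd FId)) (FHd (FTl FId))))
       (FCons FNil (FComp FMask (FCons (FTl (FHd FId)) (FTl (FTl FId))))) FNil)
    FNil.

Lemma den_answer_nil N x : den N FAnswer (Cons Nil x) = Nil.
Proof. by []. Qed.

Lemma den_answer N I E rows :
  vs_ok N I -> fam_ok N E -> size (unlist rows) <= N ->
  den N FAnswer (Cons (Cons Nil (dvs I)) (Cons (dfam E) rows)) =
  if minimal_hitting I E
  then Cons Nil (encode_bits (mask_of I (size (unlist rows)))) else Nil.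
Proof.
by move=> okI okE size_r; rewrite /= den_minimal_hitting // truthy_bool den_mask.
Qed.
#[local] Opaque FAnswer.

(** * The hypergraph of a set system *)

(** R has one row per member of the family; the edge of element i is column i of this incidence
    matrix. *)
Definition edge (R : seq bitseq) (i : nat) : seq nat :=
  rev [seq j <- iota 0 (size R) | nth false (nth [::] R j) i].

Definition FEdge :=
  FIdxFilterMap (FTl FId) (FHd (FComp FSub (FCons FElt (FHd FCtx)))) FIdx.

Lemma den_edge N i R : i <= N -> size R <= N ->
  den N FEdge (Cons (dnat i) (encode_seq encode_bits R)) = dvs (edge R i).
Proof.
move=> lei size_R; rewrite /edge -[X in rev X]map_id.
rewrite -{1}(size_map encode_bits R).
apply: (@den_idx_filter_map _ _ _ _ _ _ (map encode_bits R)) => [||j acc|//].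
- exact: unlist_encode_seq.
- by rewrite size_map.
- rewrite size_map => lt_j /=; rewrite den_sub // (nth_map [::]) //.
  elim: i (nth _ _ _) {lei} => [|i IH] [|b bs] //=.
    by rewrite -iterS iterSr; rewrite (IH [::]) nth_nil.
  by rewrite -iterS iterSr; exact: (IH bs).
Qed.
#[local] Opaque FEdge.

Definition system (R : seq bitseq) (n : nat) : seq (seq nat) :=
  rev [seq edge R i | i <- iota 0 n].

Definition FSystem :=
  FIdxFilterMap (FHd FId) FTrue (FComp FEdge (FCons FIdx (FTl FCtx))).

Lemma den_system N U R : size (unlist U) <= N -> size R <= N ->
  den N FSystem (Cons U (encode_seq encode_bits R)) = dfam (system R (size (unlist U))).
Proof.
move=> size_U size_R; rewrite /system -[iota _ _ in RHS]filter_predT.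
apply: (@den_idx_filter_map _ _ _ _ _ _ (unlist U)) => // j acc lt_j _.
by rewrite /= den_edge //; lia.
Qed.
#[local] Opaque FSystem.

(** * Branching rules *)

Definition wf_state (m n : nat) (S : state) :=
  [/\ uniq S.1, all (ltn^~ m) S.1, size S.2 <= n &
      forall e, e \in S.2 -> [/\ uniq e, all (ltn^~ m) e & ~~ has (mem S.1) e]].

(* T may still be the set of vertices found below S. *)
Definition compat (T : pred nat) (S : state) :=
  [/\ {subset S.1 <= T}, forall e, e \in S.2 -> has T e &
      forall v, v \in T -> v \notin S.1 ->
        exists2 e, e \in S.2 & v \in e /\ forall w, w \in e -> w \in T -> w = v].

(** An undecided vertex outside all remaining edges can have no private edge any more and is not
    counted. *)
Definition verts (S : state) : seq nat := undup (flatten S.2).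
Definition nverts (S : state) : nat := size (verts S).
Definition nbig (k : nat) (S : state) : nat := count (fun e => k < size e) S.2.

Lemma mem_verts (S : state) v : reflect (exists2 e, e \in S.2 & v \in e) (v \in verts S).
Proof. by rewrite mem_undup; apply: flattenP. Qed.

Lemma nverts_le (A : seq nat) (S S' : state) : uniq A -> {subset A <= verts S} ->
  {subset verts S' <= verts S} -> (forall x, x \in A -> x \notin verts S') ->
  nverts S' + size A <= nverts S.
Proof.
move=> uA sA sS dis; rewrite addnC -size_cat; apply: uniq_leq_size.
  rewrite cat_uniq uA undup_uniq andbT; apply/hasPn => x xS'.
  by apply: contraL xS' => /dis.
by move=> x; rewrite mem_cat => /orP [/sA|/sS].
Qed.

Lemma mem_assign i o (S : state) e' : reflect
  (exists e, [/\ e \in S.2, ~~ has (mem e) i & e' = diff e o]) (e' \in (assign i o S).2).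
Proof.
rewrite mem_rev; apply: (iffP mapP) => [[e]|[e [eS ei ->]]].
  by rewrite mem_filter => /andP [ei eS] ->; exists e.
by exists e; rewrite // mem_filter ei.
Qed.

Lemma mem_assign1 i o (S : state) x : (x \in (assign i o S).1) = (x \in i) || (x \in S.1).
Proof. by rewrite /= catrevE mem_cat mem_rev. Qed.

Lemma assign_wf m n i o S : wf_state m n S -> uniq i -> {subset i <= verts S} ->
  wf_state m n (assign i o S).
Proof.
move=> [uI ltI sE HE] ui si.
have iI x : x \in i -> (x < m) && (x \notin S.1).
  move=> /si /mem_verts [e eS xe]; have [_ /allP lt_e /hasPn nI] := HE _ eS.
  by apply/andP; split; [apply: lt_e | apply: nI].
split.
- rewrite /= catrevE cat_uniq rev_uniq ui uI andbT; apply/hasPn => x xI.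
  by rewrite mem_rev; apply: contraL xI => /iI /andP [].
- apply/allP => x; rewrite mem_assign1 => /orP [/iI /andP [] //|xI].
  exact: (allP ltI).
- rewrite /= size_rev size_map size_filter (leq_trans (count_size _ _)) //.
- move=> e' /mem_assign [e [eS ei ->]]; have [ue /allP lt_e /hasPn nI] := HE _ eS.
  split; first by rewrite rev_uniq filter_uniq.
  + by apply/allP => x; rewrite mem_diff => /andP [/lt_e].
  + apply/hasPn => x; rewrite mem_diff => /andP [xe _].
    rewrite inE mem_assign1 negb_or [X in _ && X]nI // andbT.
    by apply: contra ei => xi; apply/hasP; exists x.
Qed.

Lemma verts_assign_sub i o S : {subset verts (assign i o S) <= verts S}.
Proof.
move=> x /mem_verts [e' /mem_assign [e [eS _ ->]]]; rewrite mem_diff => /andP [xe _].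
by apply/mem_verts; exists e.
Qed.

Lemma nverts_assign i o S : uniq (i ++ o) -> {subset i <= verts S} ->
  {subset o <= verts S} -> nverts (assign i o S) + size (i ++ o) <= nverts S.
Proof.
move=> uio si so; apply: nverts_le => //.
- by move=> x; rewrite mem_cat => /orP [/si|/so].
- exact: verts_assign_sub.
- move=> x; rewrite mem_cat => xio; apply/mem_verts => -[e' /mem_assign [e [eS ei ->]]].
  rewrite mem_diff => /andP [xe xo]; move: xio; rewrite (negbTE xo) orbF => xi.
  by case/hasP: ei; exists x.
Qed.

Lemma nbig_assign k i o S : nbig k (assign i o S) <= nbig k S.
Proof.
rewrite /nbig /= count_rev count_map count_filter; apply: sub_count => e /= /andP [lt_k _].
by rewrite (leq_trans lt_k) // size_rev size_filter count_size.
Qed.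

(** The private edge of a vertex v outside i is not dropped: it meets T, and hence i, at most in
    v. *)
Lemma assign_compat T i o S : {subset i <= T} -> (forall x, x \in o -> x \notin T) ->
  compat T S -> compat T (assign i o S).
Proof.
move=> iT oT [IT HE HT]; split.
- by move=> x; rewrite mem_assign1 => /orP [/iT|/IT].
- move=> e' /mem_assign [e [eS _ ->]]; have /hasP [x xe xT] := HE _ eS.
  by apply/hasP; exists x; rewrite // mem_diff xe; apply: contraL xT => /oT.
- move=> v vT; rewrite mem_assign1 negb_or => /andP [vi vI].
  have [e eS [ve He]] := HT _ vT vI; exists (diff e o).
    apply/mem_assign; exists e; split=> //; apply/hasPn => x xi; apply: contra vi => xe.
    by rewrite -(He x) // iT.
  split; first by rewrite mem_diff ve; apply: contraL vT => /oT.
  by move=> w; rewrite mem_diff => /andP [we _]; apply: He.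
Qed.

Section Opts.
Variables (S : state) (e0 : seq nat).

Lemma opts_mem pre e S' : uniq (pre ++ e) -> {subset pre ++ e <= e0} ->
  S' \in opts pre e S ->
  exists v o, [/\ S' = assign [:: v] o S, uniq (v :: o), v \in e0 & {subset o <= e0}].
Proof.
elim: e pre => [//|v e IH] pre ue se /=; rewrite inE => /orP [/eqP ->|].
  exists v, pre; split=> //; last by move=> x xp; apply: se; rewrite mem_cat xp.
    by move: ue; rewrite cat_uniq /= negb_or => /and3P [-> /andP [-> _] _].
  by apply: se; rewrite mem_cat mem_head orbT.
have pe : perm_eq ((v :: pre) ++ e) (pre ++ v :: e) by rewrite perm_sym (perm_catCA pre [:: v] e).
apply: IH; first by rewrite (perm_uniq pe).
by move=> x; rewrite (perm_mem pe); apply: se.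
Qed.

Lemma opts_compat T pre e : compat T S -> (forall x, x \in pre -> x \notin T) ->
  has T e -> exists2 S', S' \in opts pre e S & compat T S'.
Proof.
move=> cS; elim: e pre => [//|v e IH] pre preT /=.
have [vT _|vT /= Te] := boolP (v \in T).
  exists (assign [:: v] pre S); first exact: mem_head.
  by apply: assign_compat => // x; rewrite inE => /eqP ->.
have [||S' S'o cS'] := IH (v :: pre).
- by move=> x; rewrite inE => /orP [/eqP -> //|/preT].
- by move: Te; rewrite (negbTE vT : T v = false).
- by exists S'; rewrite // inE S'o orbT.
Qed.

End Opts.

Section Shorten.
Variables (k : nat) (S : state) (e : seq nat) (bg : seq (seq nat)).
Hypothesis big_eq : rev [seq e <- S.2 | k < size e] = e :: bg.
Let S1 : state := (S.1, take k e :: catrev bg (rev [seq e <- S.2 | size e <= k])).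

Lemma big_mem : e \in S.2 /\ k < size e.
Proof. exact: mem_revfilter big_eq. Qed.

Lemma mem_shortened e' : e' \in S1.2 -> e' = take k e \/ e' \in S.2.
Proof.
rewrite /= inE catrevE mem_cat !mem_rev mem_filter.
case/or3P => [/eqP ->|e'bg|/andP [_ ?]]; [by left | right | by right].
have : e' \in rev [seq e <- S.2 | k < size e] by rewrite big_eq inE e'bg orbT.
by rewrite mem_rev mem_filter => /andP [].
Qed.

Lemma mem_unshortened e' : e' \in S.2 -> e' = e \/ e' \in S1.2.
Proof.
move=> e'S; rewrite /= inE catrevE mem_cat !mem_rev mem_filter e'S andbT.
have [|lt_k] := leqP (size e') k; first by rewrite !orbT; right.
have : e' \in rev [seq e <- S.2 | k < size e] by rewrite mem_rev mem_filter lt_k.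
by rewrite big_eq inE => /orP [/eqP ->|->]; [left | right; rewrite orbT].
Qed.

Lemma nverts_shortened : nverts S1 <= nverts S.
Proof.
rewrite -[nverts S1]addn0; apply: (@nverts_le [::]) => // x /mem_verts [e' e'S xe'].
case: (mem_shortened e'S) => [E|]; last by move=> ?; apply/mem_verts; exists e'.
apply/mem_verts; exists e; first by case: big_mem.
by apply: (@mem_take k); rewrite -E.
Qed.

Lemma size_big : (size bg).+1 = nbig k S.
Proof. by rewrite /nbig -size_filter -[RHS]size_rev big_eq. Qed.

Lemma nbig_shortened : nbig k S1 < nbig k S.
Proof.
rewrite -size_big ltnS /nbig /=.
rewrite size_take_min [k < minn _ _]ltnNge geq_minl /= add0n catrevE count_cat !count_rev.
rewrite count_filter [X in _ + X](_ : _ = 0) ?addn0 ?count_size //.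
by rewrite (@eq_count _ _ pred0) ?count_pred0 // => e' /=; case: ltnP.
Qed.

Lemma shortened_wf m n : wf_state m n S -> wf_state m n S1.
Proof.
move=> [uI ltI sE HE]; split=> //.
  rewrite /= catrevE size_cat !size_rev size_filter -addSn size_big /nbig.
  rewrite (leq_trans _ sE) // -(count_predC (fun e => k < size e)) leq_add2l.
  by apply: sub_count => e' /=; rewrite -leqNgt.
move=> e' /mem_shortened [->|/HE //].
have [ue lte nI] := HE e (proj1 big_mem).
split; first exact: take_uniq.
  by apply/allP => x /mem_take; apply: (allP lte).
by apply: contra nI => /hasP [x /mem_take xe xI]; apply/hasP; exists x.
Qed.

(** If e is the private edge of v, then the vertex of T among the first k of e must be v, so the
    edge cut down is still private to v. *)
Lemma shortened_compat T : compat T S -> has T (take k e) -> compat T S1.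
Proof.
move=> [IT HE HT] hT; split=> //.
  by move=> e' /mem_shortened [-> //|/HE].
move=> v vT vI; have [e' e'S [ve' He']] := HT _ vT vI.
case: (mem_unshortened e'S) => [Ee|]; last by exists e'.
rewrite Ee in He'; exists (take k e); first by rewrite /= mem_head.
case/hasP: hT => x xe xT.
have -> : v = x by rewrite (He' x) ?(mem_take xe).
split=> // w /mem_take we wT.
by rewrite (He' w) // (He' x) // (mem_take xe).
Qed.

End Shorten.

(** Each constructor records those failures of earlier rules that the analysis of its rule uses. *)
Variant children_spec (d k c : nat) (S : state) : seq state -> Prop :=
| ChildrenSmall e of e \in S.2 & size e <= d :
    children_spec d k c S (rev (opts [::] e S))
| ChildrenBig e bg of rev [seq e <- S.2 | k < size e] = e :: bg :
    children_spec d k c S (cut_big k e bg S)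
| ChildrenLow v of (forall e, e \in S.2 -> d < size e) & v \in verts S &
    low c S.2 v : children_spec d k c S (exclude_or_private v S)
| ChildrenHigh v of (forall e, e \in S.2 -> size e <= k) & v \in verts S &
    (forall w, w \in verts S -> ~~ low c S.2 w) :
    children_spec d k c S (include_or_exclude v S).

Lemma childrenP d k c S : S.2 != [::] -> children_spec d k c S (children d k c S).
Proof.
rewrite /children => nzE.
case Esm: (rev [seq e <- S.2 | size e <= d]) => [|e l]; last first.
  by have [eS le_d] := mem_revfilter Esm; constructor.
have gt_d e : e \in S.2 -> d < size e.
  by move=> eS; rewrite ltnNge; apply: revfilter_nil Esm eS.
case Ebg: (rev [seq e <- S.2 | k < size e]) => [|e l]; last exact: ChildrenBig.
have le_k e : e \in S.2 -> size e <= k.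
  by move=> eS; rewrite leqNgt; apply: revfilter_nil Ebg eS.
case Elo: (rev [seq e <- S.2 | has (low c S.2) e]) => [|e l]; last first.
  have [eS lo] := mem_revfilter Elo.
  have : head 0 (rev [seq v <- e | low c S.2 v]) \in [seq v <- e | low c S.2 v].
    rewrite -mem_rev; case Ev: (rev [seq v <- e | low c S.2 v]) => [|v r].
      by move: lo; rewrite has_filter -size_eq0 -size_rev Ev.
    exact: mem_head.
  rewrite mem_filter => /andP [lov ve]; apply: ChildrenLow => //.
  by apply/mem_verts; exists e.
apply: ChildrenHigh => //.
  case ES: S.2 nzE => [//|e E] _; have eS : e \in S.2 by rewrite ES mem_head.
  apply/mem_verts; exists e => //; have := gt_d _ eS; case: (e) => // v e' _.
  exact: mem_head.
move=> w /mem_verts [e eS we]; apply: contra (revfilter_nil Elo eS) => lo.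
by apply/hasP; exists w.
Qed.

Lemma sub_verts (S : state) e : e \in S.2 -> {subset e <= verts S}.
Proof. by move=> eS v ve; apply/mem_verts; exists e. Qed.

Lemma mem_guess_private v S S' : S' \in guess_private v S ->
  exists2 e, e \in S.2 & v \in e /\ S' = assign [:: v] (diff e [:: v]) S.
Proof.
by rewrite mem_rev => /mapP [e]; rewrite mem_filter => /andP [ve eS] ->; exists e.
Qed.

Lemma diff_sub e o : {subset diff e o <= e}.
Proof. by move=> x; rewrite mem_diff => /andP []. Qed.

Lemma nverts_assign_private m n v S e : wf_state m n S -> e \in S.2 -> v \in e ->
  nverts (assign [:: v] (diff e [:: v]) S) + size e <= nverts S.
Proof.
move=> [_ _ _ HE] eS ve; have [ue _ _] := HE _ eS; have sub := sub_verts eS.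
have ud : uniq ([:: v] ++ diff e [:: v]).
  by rewrite /= mem_diff mem_head andbF rev_uniq filter_uniq.
apply: leq_trans (nverts_assign ud _ _).
- rewrite leq_add2l; apply: uniq_leq_size => // x xe.
  by rewrite mem_cat mem_diff xe; case: (x \in _).
- by move=> x; rewrite inE => /eqP ->; apply: sub.
- by move=> x /diff_sub /sub.
Qed.

(** * Progress and completeness of the branching *)

Section Children.
Variables (m n d k c : nat) (S : state).
Hypotheses (k_gt0 : 0 < k) (invS : wf_state m n S) (nzE : S.2 != [::]).

Let uniq_edge e : e \in S.2 -> uniq e.
Proof. by case: invS => _ _ _ H /H []. Qed.

Let sub1 v : v \in verts S -> {subset [:: v] <= verts S}.
Proof. by move=> vS x; rewrite inE => /eqP ->. Qed.

Lemma nverts_exclude v : v \in verts S -> (nverts (assign [::] [:: v] S)).+1 <= nverts S.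
Proof. by move=> vS; rewrite -addn1; apply: nverts_assign => //; apply: sub1. Qed.

Lemma nverts_include v : v \in verts S -> (nverts (assign [:: v] [::] S)).+1 <= nverts S.
Proof. by move=> vS; rewrite -addn1; apply: nverts_assign => //; apply: sub1. Qed.

Lemma nverts_exclude_take e : e \in S.2 -> k < size e ->
  nverts (assign [::] (take k e) S) + k <= nverts S.
Proof.
move=> eS lt_k; have := @nverts_assign [::] (take k e) S.
rewrite size_take lt_k; apply=> //; first exact/take_uniq/uniq_edge.
by move=> x /mem_take; apply: sub_verts.
Qed.

(** Cutting a big edge need not decide a vertex, but makes the number of big edges drop; all other
    children decide a vertex. The sum thus bounds the depth of the search. *)
Lemma children_progress S' : S' \in children d k c S ->
  wf_state m n S' /\ nverts S' + nbig k S' < nverts S + nbig k S.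
Proof.
case: (childrenP d k c nzE) => [e eS le_d|e bg bigE|v gt_d vS lov|v le_k vS nlo].
- rewrite mem_rev => /(@opts_mem _ e) [] //; first exact: uniq_edge.
  move=> v [o [-> uvo ve oe]]; have sub := sub_verts eS.
  have sv : {subset [:: v] <= verts S} by apply/sub1/sub.
  split; first exact: assign_wf.
  have so : {subset o <= verts S} by move=> x /oe /sub.
  have := @nverts_assign [:: v] o S uvo sv so; have := nbig_assign k [:: v] o S.
  by rewrite /=; lia.
- have [eS lt_k] := big_mem bigE.
  rewrite !inE => /orP [/eqP ->|/eqP ->].
    split; first exact: (shortened_wf bigE).
    have := nverts_shortened bigE; have := nbig_shortened bigE; lia.
  split; first exact: assign_wf.
  rewrite -addSn leq_add ?nbig_assign //.
  by rewrite (leq_trans _ (nverts_exclude_take eS lt_k)) // -addn1 leq_add2l.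
- rewrite inE => /orP [/eqP ->|/mem_guess_private [e eS [ve ->]]].
    split; first exact: assign_wf.
    by rewrite -addSn leq_add ?nbig_assign ?nverts_exclude.
  split; first by apply: assign_wf => //; apply: sub1.
  rewrite -addSn leq_add ?nbig_assign //.
  rewrite (leq_trans _ (nverts_assign_private invS eS ve)) // -addn1 leq_add2l.
  by case: (e) ve.
- rewrite !inE => /orP [/eqP ->|/eqP ->].
    split; first by apply: assign_wf => //; apply: sub1.
    by rewrite -addSn leq_add ?nbig_assign ?nverts_include.
  split; first exact: assign_wf.
  by rewrite -addSn leq_add ?nbig_assign ?nverts_exclude.
Qed.

Lemma exclude_compat T v : compat T S -> v \notin T -> compat T (assign [::] [:: v] S).
Proof. by move=> cS vT; apply: assign_compat => // x; rewrite inE => /eqP ->. Qed.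

(** The right child depends on how T meets the selected edge or vertex. Spurious children do no
    harm, as candidates are tested at the leaves. *)
Lemma children_compat T : compat T S ->
  exists2 S', S' \in children d k c S & compat T S'.
Proof.
move=> cS; have [IT HE HT] := cS.
case: (childrenP d k c nzE) => [e eS le_d|e bg bigE|v gt_d vS lov|v le_k vS nlo].
- have [|S' S'o cS'] := @opts_compat S T [::] e cS _ (HE _ eS); first by [].
  by exists S'; rewrite // mem_rev.
- have [hT|nT] := boolP (has T (take k e)).
    exists (S.1, take k e :: catrev bg (rev [seq e <- S.2 | size e <= k])).
      exact: mem_head.
    exact: (shortened_compat bigE).
  exists (assign [::] (take k e) S); first by rewrite !inE eqxx orbT.
  by apply: assign_compat => // x xe; apply: contra nT => xT; apply/hasP; exists x.
- have [vT|vT] := boolP (v \in T); last first.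
    exists (assign [::] [:: v] S); first exact: mem_head.
    exact: exclude_compat.
  have vI : v \notin S.1.
    case/mem_verts: vS => e eS ve; case: invS => _ _ _ /(_ _ eS) [_ _ /hasPn].
    by apply.
  (* Compatibility provides a private edge e of v among the remaining edges; T avoids the rest of e,
     so the child that guesses e is the right one. *)
  have [e eS [ve He]] := HT _ vT vI.
  exists (assign [:: v] (diff e [:: v]) S).
    rewrite inE mem_rev; apply/orP; right; apply/mapP; exists e => //.
    by rewrite mem_filter ve.
  apply: assign_compat => // x; first by rewrite inE => /eqP ->.
  rewrite mem_diff inE => /andP [xe]; apply: contra => xT.
  by rewrite (He x).
- have [vT|vT] := boolP (v \in T).
    exists (assign [:: v] [::] S); first exact: mem_head.
    by apply: assign_compat => // x; rewrite inE => /eqP ->.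
  exists (assign [::] [:: v] S); first by rewrite !inE eqxx orbT.
  exact: exclude_compat.
Qed.

Lemma size_opts pre e : size (opts pre e S) = size e.
Proof. by elim: e pre => //= v e IH pre; rewrite IH. Qed.

Lemma size_guess_private v : size (guess_private v S) = count (fun e => v \in e) S.2.
Proof. by rewrite size_rev size_map size_filter. Qed.

Lemma size_children : size (children d k c S) <= d + c + 2.
Proof.
case: (childrenP d k c nzE) => [e eS le_d|e bg bigE|v gt_d vS lov|v le_k vS nlo] /=.
- by rewrite size_rev size_opts (leq_trans le_d) // -addnA leq_addr.
- by lia.
- by rewrite size_guess_private (leq_ltn_trans lov) //; lia.
- by lia.
Qed.

(** Double counting of incidences: every vertex lies in more than c edges, and at most n edges have
    at most k vertices each. *)
Lemma nverts_high : (forall e, e \in S.2 -> size e <= k) ->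
  (forall w, w \in verts S -> ~~ low c S.2 w) -> c.+1 * nverts S <= k * n.
Proof.
move=> le_k nlo.
have -> : c.+1 * nverts S = \sum_(v <- verts S) c.+1.
  by rewrite big_const_seq count_predT iter_addn_0.
have cnt (T : Type) (p : pred T) s : \sum_(i <- s) p i = count p s.
  by rewrite -sum1_count [RHS]big_mkcond; apply: eq_bigr => i _; case: (p i).
apply: (@leq_trans (\sum_(v <- verts S) \sum_(e <- S.2) (v \in e))).
  rewrite big_seq [leqRHS]big_seq; apply: leq_sum => v /nlo.
  by rewrite -ltnNge (cnt _ (fun e : seq nat => v \in e)).
rewrite exchange_big /=.
apply: (@leq_trans (\sum_(e <- S.2) k)).
  rewrite big_seq [leqRHS]big_seq; apply: leq_sum => e eS; apply: leq_trans (le_k e eS).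
  rewrite (cnt _ (mem e)) -size_filter; apply: uniq_leq_size.
    by rewrite filter_uniq ?undup_uniq.
  by move=> x; rewrite mem_filter => /andP [].
rewrite big_const_seq count_predT iter_addn_0 leq_mul2l.
by case: invS => _ _ -> _; rewrite orbT.
Qed.

End Children.

(** * Potential *)

Section Weight.
Local Open Scope ring_scope.
Variables (R : realFieldType) (a y x : R) (u0 m n d k c : nat).
Hypotheses (a_gt0 : 0 < a) (a_le1 : a <= 1) (y_ge1 : 1 <= y) (x_ge1 : 1 <= x).
Hypothesis y_eq : y = 2 * a.

(** Deciding a vertex divides the weight by 1/a as long as more than [u0] are left, and by y/a = 2
    afterwards, which suits plain binary branching. *)
Definition weight (u b : nat) : R := a^-1 ^+ u * y ^+ minn u u0 * x ^+ b.

Lemma weight_ge1 u b : 1 <= weight u b.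
Proof.
by rewrite /weight !mulr_ege1 ?exprn_ege1 // invf_ge1.
Qed.

Lemma weight_step u b : weight u b <= a * weight u.+1 b.
Proof.
rewrite /weight exprS !mulrA divff ?gt_eqF // mul1r.
have x_ge0 : 0 <= x by rewrite (le_trans ler01).
apply: ler_wpM2r; first exact: exprn_ge0.
apply: ler_wpM2l; first by rewrite exprn_ge0 // invr_ge0 ltW.
by apply: ler_weXn2l => //; lia.
Qed.

Lemma weight_halve u b : (u < u0)%N -> 2 * weight u b <= weight u.+1 b.
Proof.
move=> lt_u; rewrite /weight !(minn_idPl _) ?(ltnW lt_u) // !exprS.
have -> : a^-1 * a^-1 ^+ u * (y * y ^+ u) * x ^+ b =
          (a^-1 * y) * (a^-1 ^+ u * y ^+ u * x ^+ b) by ring.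
have -> // : a^-1 * y = 2 by rewrite y_eq mulrCA mulVf ?mulr1 ?gt_eqF.
Qed.

Lemma weight_leb u b b' : (b <= b')%N -> weight u b <= weight u b'.
Proof.
move=> le_b; rewrite /weight ler_wpM2l ?mulr_ge0 ?exprn_ge0 ?invr_ge0 ?(ltW a_gt0) //.
  by rewrite (le_trans ler01).
exact: ler_weXn2l.
Qed.

Lemma weight_le i u u' b b' : (u + i <= u')%N -> (b <= b')%N ->
  weight u b <= a ^+ i * weight u' b'.
Proof.
move=> le_u le_b; apply: (le_trans (weight_leb u le_b)).
have ge0 v : 0 <= weight v b' by rewrite (le_trans ler01) // weight_ge1.
have {le_u} [l ->] : exists l, u' = (u + i + l)%N by exists (u' - (u + i))%N; lia.
elim: l => [|l IH].
  rewrite addn0; elim: i => [|i IH]; first by rewrite addn0 mul1r.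
  apply: (le_trans IH); rewrite exprSr -mulrA addnS.
  by apply: ler_wpM2l (weight_step _ _); rewrite exprn_ge0 // ltW.
apply: (le_trans IH); rewrite addnS; apply: ler_wpM2l; first by rewrite exprn_ge0 // ltW.
by apply: (le_trans (weight_step _ _)); rewrite ler_piMl.
Qed.

Definition sweight (S : state) : R := weight (nverts S) (nbig k S).

Lemma sweight_ge0 S : 0 <= sweight S.
Proof. by rewrite (le_trans ler01) // weight_ge1. Qed.

(** The branch that passes over i vertices decides i + 1 of them and contributes a factor a^(i +
    1). *)
Lemma sweight_opts S e pre : uniq (pre ++ e) -> {subset pre ++ e <= verts S} ->
  \sum_(S' <- opts pre e S) sweight S' <=
  (\sum_(size pre <= i < size pre + size e) a ^+ i.+1) * sweight S.
Proof.
elim: e pre => [|v e IH] pre upe spe.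
  by rewrite big_nil addn0 big_geq ?mul0r.
rewrite big_cons addnS big_ltn ?ltnS ?leq_addr // mulrDl -addSn; apply: lerD; last first.
  have pe : perm_eq ((v :: pre) ++ e) (pre ++ v :: e).
    by rewrite perm_sym (perm_catCA pre [:: v] e).
  apply: (IH (v :: pre)); first by rewrite (perm_uniq pe).
  by move=> z; rewrite (perm_mem pe); apply: spe.
apply: weight_le; last exact: nbig_assign.
have := @nverts_assign [:: v] pre S; apply.
- by move: upe; rewrite cat_uniq /= negb_or => /and3P [-> /andP [-> _] _].
- by move=> z; rewrite inE => /eqP ->; apply: spe; rewrite mem_cat mem_head orbT.
- by move=> z zp; apply: spe; rewrite mem_cat zp.
Qed.

(** One condition per rule: small edges, big edges, vertices of low degree, and the bound from
    double counting when all degrees are high. *)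
Hypothesis small_le1 : forall l, (l <= d)%N -> \sum_(0 <= i < l) a ^+ i.+1 <= 1.
Hypothesis big_le : 1 + a ^+ k * x <= x.
Hypothesis low_le1 : a + a ^+ d.+1 * c%:R <= 1.
Hypothesis high_le : forall u, (c.+1 * u <= k * n)%N -> (u <= u0)%N.

Lemma sweight_children S : wf_state m n S -> S.2 != [::] ->
  \sum_(S' <- children d k c S) sweight S' <= sweight S.
Proof.
move=> invS nzE; have wS := sweight_ge0 S.
have uniq_edge e : e \in S.2 -> uniq e by case: invS => _ _ _ H /H [].
case: (childrenP d k c nzE) => [e eS le_d|e bg bigE|v gt_d vS lov|v le_k vS nlo].
- rewrite (perm_big (opts [::] e S)) /=; last by rewrite perm_rev.
  have /le_trans := @sweight_opts S e [::] (uniq_edge _ eS) (sub_verts eS).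
  by apply; rewrite add0n ler_piMl // small_le1.
- have [eS lt_k] := big_mem bigE.
  rewrite big_cons big_seq1.
  have lt_b := nbig_shortened bigE.
  have [b Eb] : exists b, nbig k S = b.+1.
    by exists (nbig k S).-1; rewrite (ltn_predK lt_b).
  rewrite Eb ltnS in lt_b.
  (* With the factor x of the edge to be cut split off, the two children sum to at most 1 + a^k x
     times the rest. *)
  have w1 : sweight S = x * weight (nverts S) b.
    by rewrite /sweight Eb /weight exprS mulrCA.
  have w_ge0 : 0 <= weight (nverts S) b by rewrite (le_trans ler01) // weight_ge1.
  have := @weight_le k _ _ _ _ (nverts_exclude_take invS eS lt_k)
    (nbig_assign k [::] (take k e) S).
  rewrite -!/(sweight _) w1 => w2.
  have : sweight (S.1, take k e :: catrev bg (rev [seq e <- S.2 | (size e <= k)%N]))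
      <= a ^+ 0 * weight (nverts S) b.
    by apply: weight_le lt_b; rewrite addn0 (nverts_shortened bigE).
  rewrite mul1r => w3; apply: (le_trans (lerD w3 w2)).
  by rewrite mulrA -[X in X + _]mul1r -mulrDl ler_wpM2r.
- rewrite big_cons.
  have w1 : sweight (assign [::] [:: v] S) <= a * sweight S.
    rewrite -[a]expr1; apply: weight_le; last exact: nbig_assign.
    by rewrite addn1; apply: nverts_exclude.
  have w2 : \sum_(S' <- guess_private v S) sweight S' <= a ^+ d.+1 * c%:R * sweight S.
    apply: (@le_trans _ _ (\sum_(S' <- guess_private v S) a ^+ d.+1 * sweight S)).
      rewrite !big_seq; apply: ler_sum => S' /mem_guess_private [e eS [ve ->]].
      apply: weight_le; last exact: nbig_assign.
      apply: leq_trans (nverts_assign_private invS eS ve).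
      by rewrite leq_add2l gt_d.
    rewrite big_const_seq count_predT size_guess_private iter_addr_0.
    rewrite -mulrnAl -mulr_natr; apply: ler_wpM2r => //; apply: ler_wpM2l.
      by rewrite exprn_ge0 // ltW.
    by rewrite ler_nat.
  by rewrite (le_trans (lerD w1 w2)) // -mulrDl ler_piMl.
- rewrite big_cons big_seq1.
  (* At most [u0] vertices are left, where deciding a vertex halves the weight, so two children are
     affordable. *)
  have le_u := high_le (nverts_high invS le_k nlo).
  have lt_u : (0 < nverts S)%N by rewrite /nverts; case: (verts S) vS.
  have w1 S' : (nverts S' < nverts S)%N -> (nbig k S' <= nbig k S)%N ->
      2 * sweight S' <= sweight S.
    move=> lt_S' le_b.
    have [u Eu] : exists u, nverts S = u.+1.
      by exists (nverts S).-1; rewrite prednK.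
    rewrite Eu ltnS in lt_S'; rewrite Eu in le_u.
    apply: (@le_trans _ _ (2 * weight u (nbig k S))).
      have := @weight_le 0 (nverts S') u (nbig k S') (nbig k S).
      by rewrite mul1r addn0 => H; rewrite ler_pM2l // H.
    by rewrite /sweight Eu weight_halve.
  have := w1 _ (nverts_include vS) (nbig_assign k [:: v] [::] S).
  have := w1 _ (nverts_exclude vS) (nbig_assign k [::] [:: v] S).
  lra.
Qed.

End Weight.

(** * Set covers as hitting sets *)

Lemma encode_seq_map (T T' : Type) (f : T' -> data) (g : T -> T') (s : seq T) :
  encode_seq f (map g s) = encode_seq (f \o g) s.
Proof. by elim: s => //= x s ->. Qed.

Lemma uniq_lt_size (m : nat) (e : seq nat) : uniq e -> all (ltn^~ m) e -> size e <= m.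
Proof.
move=> ue /allP lt_e; rewrite -(size_iota 0 m); apply: uniq_leq_size => // x xe.
by rewrite mem_iota; apply: lt_e.
Qed.

Section Cover.
Variables (n : nat) (F : {set {set 'I_n}}) (s : seq {set 'I_n}).
Hypothesis sF : perm_eq s (enum F).

Definition rows : seq bitseq := [seq [seq i \in A | i <- enum 'I_n] | A : {set 'I_n} <- s].
Definition edges : seq (seq nat) := system rows n.

Let us : uniq s. Proof. by rewrite (perm_uniq sF) enum_uniq. Qed.
Let mem_s A : (A \in s) = (A \in F). Proof. by rewrite (perm_mem sF) mem_enum. Qed.

Lemma size_rows : size rows = size s. Proof. exact: size_map. Qed.

Lemma mem_edge (i : 'I_n) j :
  (j \in edge rows i) = (j < size s) && (i \in nth set0 s j).
Proof.
rewrite mem_rev mem_filter mem_iota add0n /= andbC size_rows.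
case: ltnP => //= lt_j.
by rewrite (nth_map set0) // (nth_map i) ?size_enum_ord // nth_ord_enum.
Qed.

Lemma edgesP e : reflect (exists i : 'I_n, e = edge rows i) (e \in edges).
Proof.
rewrite mem_rev; apply: (iffP mapP) => [[i]|[i ->]].
  by rewrite mem_iota => /= lt_i ->; exists (Ordinal lt_i).
by exists (nat_of_ord i); rewrite // mem_iota /=.
Qed.

Lemma edges_wf : wf_state (size s) n ([::], edges).
Proof.
split=> //; first by rewrite /= size_rev size_map size_iota.
move=> e /edgesP [i ->]; split.
- by rewrite rev_uniq filter_uniq // iota_uniq.
- by apply/allP => j; rewrite mem_edge => /andP [].
- by apply/hasPn.
Qed.

Definition indices (C : {set {set 'I_n}}) : pred nat :=
  fun j => (j < size s) && (nth set0 s j \in C).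

(** Without a member A, a minimal cover leaves some element i uncovered; the edge of i is private to
    the index of A. *)
Lemma minimal_cover_compat C :
  minimal_set_cover F C -> compat (indices C) ([::], edges).
Proof.
case/andP => /andP [/subsetP sCF /eqP covC] /forallP minC; split=> //.
  move=> e /edgesP [i ->].
  have : i \in cover C by rewrite covC inE.
  case/bigcupP => A AC iA; have As : A \in s by rewrite mem_s sCF.
  apply/hasP; exists (index A s); first by rewrite mem_edge index_mem As nth_index.
  by rewrite /indices index_mem As nth_index.
move=> v /andP [lt_v vC] _; set A := nth set0 s v in vC.
have := minC (C :\ A); rewrite properD1 //= negb_and.
have -> : C :\ A \subset F.
  by apply/subsetP => B; rewrite inE => /andP [_ /sCF].
move=> /= ncov.
have [i inc] : exists i, i \notin cover (C :\ A).
  apply/existsP; rewrite -negb_forall; apply: contra ncov => /forallP H.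
  by apply/eqP/setP => i; rewrite inE; apply: H.
have only B : B \in C -> i \in B -> B = A.
  move=> BC iB; apply/eqP; apply: contraR inc => neB.
  by apply/bigcupP; exists B; rewrite // !inE neB.
have : i \in cover C by rewrite covC inE.
case/bigcupP => B BC iB; have EB := only B BC iB.
exists (edge rows i); first by apply/edgesP; exists i.
rewrite mem_edge lt_v -/A -EB; split=> // w; rewrite mem_edge => /andP [lt_w iw].
case/andP => _ wC; apply/eqP; rewrite -(nth_uniq set0 lt_w lt_v us).
by apply/eqP; apply: only.
Qed.

(** With no edge left, a vertex of T outside I would lack a private edge, so I is T. *)
Lemma compat_minimal_hitting T I : compat T ([::], edges) -> compat T (I, [::]) ->
  minimal_hitting I edges /\ I =i T.
Proof.
move=> [_ hitT privT] [IT _ TI].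
have eqIT : I =i T.
  move=> v; apply/idP/idP => [/IT //|vT]; apply: contraT => vI.
  by have [] := TI _ vT vI.
split=> //; apply/andP; split; apply/allP.
  move=> e /hitT /hasP [v ve vT]; apply/hasP; exists v => //.
  by rewrite eqIT.
move=> v; rewrite eqIT => vT; have [//|e eE [ve He]] := privT v vT.
apply/hasP; exists e => //; rewrite ve /=; apply/hasPn => w; rewrite eqIT => wT.
by apply/negP => /andP [we /eqP]; apply; apply: He.
Qed.

Lemma mask_of_indices C I : I =i indices C ->
  mask_of I (size s) = [seq A \in C | A <- s].
Proof.
move=> eqI; apply: (@eq_from_nth _ false); first by rewrite !size_map size_iota.
move=> j; rewrite size_map size_iota => lt_j.
rewrite (nth_map 0) ?size_iota // (nth_map set0) // nth_iota // add0n.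
by rewrite eqI unfold_in /indices lt_j.
Qed.

(** A private edge of v is an element covered by the v-th member only, so no subfamily omitting that
    member is a cover. *)
Lemma minimal_hitting_cover I : all (ltn^~ (size s)) I -> minimal_hitting I edges ->
  exists2 C, minimal_set_cover F C & mask_of I (size s) = [seq A \in C | A <- s].
Proof.
move=> /allP ltI /andP [/allP hit /allP priv].
pose C := [set A in [seq nth set0 s j | j <- I]].
have memC A : reflect (exists2 j, j \in I & A = nth set0 s j) (A \in C).
  by rewrite inE; apply: mapP.
exists C; last first.
  apply: mask_of_indices => j; rewrite unfold_in /indices.
  apply/idP/idP => [jI|/andP [lt_j /memC [j' j'I /eqP]]].
    rewrite (ltI _ jI : _ < _) /=; apply/memC; by exists j.
  by rewrite nth_uniq ?(ltI _ j'I : _ < _) // => /eqP ->.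
apply/andP; split.
  apply/andP; split.
    apply/subsetP => A /memC [j /ltI lt_j ->]; by rewrite -mem_s mem_nth.
  apply/eqP/setP => i; rewrite inE; apply/bigcupP.
  have /hit /hasP [j jI] : edge rows i \in edges by apply/edgesP; exists i.
  rewrite inE mem_edge => /andP [lt_j iA]; exists (nth set0 s j) => //.
  by apply/memC; exists j.
apply/forallP => C'; apply/implyP => /properP [sC' [A AC AC']].
apply/negP => /andP [_ /eqP covC'].
case/memC: AC => v vI EA; have /hasP [e eE /andP [ve /hasPn noth]] := priv _ vI.
case/edgesP: eE => i Ee; rewrite {}Ee in ve noth.
have : i \in cover C' by rewrite covC' inE.
case/bigcupP => B BC' iB; have /memC [w wI EB] := subsetP sC' _ BC'.
have := noth w wI; rewrite mem_edge (ltI _ wI : _ < _) -EB iB /= negbK => /eqP Ew.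
by move: AC'; rewrite EA -Ew -EB BC'.
Qed.

End Cover.

(** * The search tree *)

Lemma wf_vs_ok m n N S e : wf_state m n S -> n + m <= N -> e \in S.2 -> vs_ok N e.
Proof.
move=> [_ _ _ HE] leN /HE [ue lt_e _]; apply/andP; split.
  by rewrite (leq_trans (uniq_lt_size ue lt_e)) //; lia.
by apply/allP => x /(allP lt_e) /= lt_x; lia.
Qed.

Lemma wf_fam_ok m n N S : wf_state m n S -> n + m <= N -> fam_ok N S.2.
Proof.
move=> wfS leN; apply/andP; split; last by apply/allP => e; apply: wf_vs_ok wfS leN.
by case: wfS => _ _ sE _; rewrite (leq_trans sE) //; lia.
Qed.

Lemma wf_chosen_ok m n N S : wf_state m n S -> n + m <= N -> vs_ok N S.1.
Proof.
move=> [uI ltI _ _] leN; apply/andP; split.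
  by rewrite (leq_trans (uniq_lt_size uI ltI)) //; lia.
by apply/allP => x /(allP ltI) /= lt_x; lia.
Qed.

Lemma leaves_iter T t : leaves (iter T Step t) = leaves t.
Proof. by elim: T. Qed.

Lemma path_time_iter T t : path_time (iter T Step t) = T + path_time t.
Proof. by elim: T => //= T ->. Qed.

Lemma size_leaves_gt0 t : 0 < size (leaves t).
Proof. by elim: t => //= t1 H1 t2 H2; rewrite size_cat addn_gt0 H1. Qed.

(** The root-to-leaf paths, one per leaf, cover all nodes. *)
Lemma total_time_le t : total_time t <= size (leaves t) * path_time t.
Proof.
elim: t => //= [t IH|t1 IH1 t2 IH2]; first by have := size_leaves_gt0 t; nia.
rewrite size_cat; have := size_leaves_gt0 t1; have := size_leaves_gt0 t2.
have := leq_maxl (path_time t1) (path_time t2).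
have := leq_maxr (path_time t1) (path_time t2); nia.
Qed.

(** * The main loop *)

Section Loop.
Variables (R : realFieldType) (m n N d k c : nat) (sw : state -> R).
Variables (E0 : seq (seq nat)) (rws : data).
Hypotheses (k_gt0 : 0 < k) (leN : n + m <= N).
Hypothesis sw_ge1 : forall S, (1 <= sw S)%R.
Hypothesis sw_children : forall S, wf_state m n S -> S.2 != [::] ->
  (\sum_(S' <- children d k c S) sw S' <= sw S)%R.

Definition out (I : seq nat) : data :=
  den N FAnswer (Cons (Cons Nil (dvs I)) (Cons (dfam E0) rws)).

(** The full specification relative to the pending states Q, in a form that passes through commands:
    soundness and completeness of the leaves, p bounding the paths and w the number of leaves. *)
Definition explores (p : nat) (w : R) (Q : seq state) (ks : seq cmd) (st : store) :=
  exists t, [/\ search_tree ks st t,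
    forall l, l \in leaves t -> l = Nil \/ exists2 I, wf_state m n (I, [::]) & l = out I,
    forall T S, S \in Q -> compat T S ->
      exists2 I, wf_state m n (I, [::]) /\ compat T (I, [::]) & out I \in leaves t,
    path_time t <= p & ((size (leaves t))%:R <= w)%R].

Lemma explores_le p p' w w' Q Q' ks st : p <= p' -> (w <= w')%R ->
  (forall T S', S' \in Q' -> compat T S' -> exists2 S, S \in Q & compat T S) ->
  explores p w Q ks st -> explores p' w' Q' ks st.
Proof.
move=> le_p le_w sub [t [H1 H2 H3 H4 H5]]; exists t; split=> //.
- by move=> T S' S'Q' cS'; have [S SQ cS] := sub _ _ S'Q' cS'; apply: H3 SQ cS.
- exact: leq_trans le_p.
- exact: le_trans le_w.
Qed.

Lemma explores_reaches T p w Q cm ks st P : reaches T cm st P ->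
  (forall st', P st' -> explores p w Q ks st') -> explores (T + p) w Q (cm :: ks) st.
Proof.
move=> [T' [st' [le_T Pst' Rst]]] /(_ _ Pst') [t [H1 H2 H3 H4 H5]].
exists (iter T' Step t); rewrite leaves_iter path_time_iter; split=> //.
  exact: Rst.
exact: leq_add.
Qed.

Lemma explores_if p w Q e c1 c2 ks st :
  explores p w Q ((if truthy (eval st e) then c1 else c2) :: ks) st ->
  explores p.+1 w Q (If e c1 c2 :: ks) st.
Proof.
by move=> [t [H1 H2 H3 H4 H5]]; exists (Step t); split=> //; apply: STIf.
Qed.

Lemma explores_while p w Q e cm ks st :
  explores p w Q (if truthy (eval st e) then cm :: While e cm :: ks else ks) st ->
  explores p.+1 w Q (While e cm :: ks) st.
Proof.
by move=> [t [H1 H2 H3 H4 H5]]; exists (Step t); split=> //; apply: STWhile.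
Qed.

Lemma explores_branch p w1 w2 Q1 Q2 c1 c2 ks st :
  explores p w1 Q1 (c1 :: ks) st -> explores p w2 Q2 (c2 :: ks) st ->
  explores p.+1 (w1 + w2)%R (Q1 ++ Q2) (Branch c1 c2 :: ks) st.
Proof.
move=> [t1 [A1 A2 A3 A4 A5]] [t2 [B1 B2 B3 B4 B5]]; exists (Fork t1 t2); split=> /=.
- exact: STBranch.
- by move=> l; rewrite mem_cat => /orP [/A2|/B2].
- move=> T S; rewrite mem_cat => /orP [SQ|SQ] cS.
    by have [I HI oI] := A3 _ _ SQ cS; exists I; rewrite // mem_cat oI.
  by have [I HI oI] := B3 _ _ SQ cS; exists I; rewrite // mem_cat oI orbT.
- by rewrite ltnS geq_max A4.
- by rewrite size_cat natrD lerD.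
Qed.

(* Variables: 1 clock, 2 edges, 3 rows of the input, 4 list of the states still to
   be explored, 5 [Cons Nil] of the chosen vertices once all edges are hit. *)
Definition finish : cmd :=
  Assign 6 (ECons (EVar 5) (ECons (EVar 2) (EVar 3))) ;;
  comp FAnswer 6 ;; Assign 0 (EVar 6).

(** A list of several states is split by a binary branch into its head and its tail. A single state
    is replaced by its children or, once all edges are hit, stored as a candidate; the list is then
    emptied, which ends the loop. *)
Definition body : cmd :=
  If (ETl (EVar 4))
    (Branch (Assign 4 (ECons (EHd (EVar 4)) ENil)) (Assign 4 (ETl (EVar 4))))
    (If (ETl (EHd (EVar 4)))
       (Assign 6 (EHd (EVar 4)) ;; comp (FChildren d k c) 6 ;; Assign 4 (EVar 6))
       (Assign 5 (ECons ENil (EHd (EHd (EVar 4)))) ;; Assign 4 ENil)).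

Definition loop : cmd := While (EVar 4) body.

Definition ready (st : store) :=
  [/\ size (unlist (st 1)) = N, st 2 = dfam E0 & st 3 = rws].

Lemma finish_reaches st : ready st ->
  reaches (cost N FAnswer + 4) finish st
    (fun st' => st' 0 = den N FAnswer (Cons (st 5) (Cons (dfam E0) rws))).
Proof.
move=> [clk r2 r3]; apply: (@reaches_leq (cost N FAnswer + 1).+1.+2); first by lia.
apply: reaches_assign_seq; apply: reaches_seq; first by apply: comp_reaches; [|upd].
move=> st1 /= [_ eq1]; apply: reaches_assign; rewrite /= update_eq eq1.
by upd; rewrite /= r2 r3.
Qed.

Lemma explores_nil st w : ready st -> st 4 = Nil -> st 5 = Nil -> (1 <= w)%R ->
  explores (cost N FAnswer + 6) w [::] [:: loop; finish] st.
Proof.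
move=> rdy r4 r5 w_ge1.
apply: (@explores_le (cost N FAnswer + 4 + 1).+1 _ w _ [::]) => //; first by lia.
apply: explores_while; rewrite /= r4 /=.
apply: explores_reaches (finish_reaches rdy) _ => st' eq0.
exists (Leaf (st' 0)); split=> //; first exact: STLeaf.
by move=> l; rewrite inE => /eqP ->; left; rewrite eq0 r5 den_answer_nil.
Qed.

Lemma explores_chosen st w S : ready st -> wf_state m n S -> S.2 = [::] ->
  st 4 = Nil -> st 5 = Cons Nil (dvs S.1) -> (1 <= w)%R ->
  explores (cost N FAnswer + 6) w [:: S] [:: loop; finish] st.
Proof.
case: S => I E rdy wfS /= E_nil r4 r5 w_ge1; rewrite {}E_nil in wfS *.
apply: (@explores_le (cost N FAnswer + 4 + 1).+1 _ w _ [:: (I, [::])]) => //; first by lia.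
  by move=> T S' S'Q cS'; exists S'.
apply: explores_while; rewrite /= r4 /=.
apply: explores_reaches (finish_reaches rdy) _ => st' eq0.
have {}eq0 : st' 0 = out I by rewrite eq0 r5.
exists (Leaf (st' 0)); split=> //; first exact: STLeaf.
- by move=> l; rewrite inE => /eqP ->; right; exists I.
- move=> T S; rewrite inE => /eqP -> cS; exists I => //.
  by rewrite inE eq0.
Qed.

(** The last term pays for splitting the list of at most [d + c + 2] children into single states. *)
Definition step_time := cost N (FChildren d k c) + 15 + 5 * (d + c + 2).
Definition end_time := cost N FAnswer + 20.

(** Outer induction on a bound M for the measure of the pending states, inner induction on their
    list. An empty list still gives one leaf, whence the case distinction in the weight. *)
Lemma loop_explores M Q st :
  (forall S, S \in Q -> wf_state m n S /\ nverts S + nbig k S < M) ->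
  ready st -> st 4 = dstates Q -> st 5 = Nil ->
  explores (M * step_time + 5 * size Q + end_time)
    (if Q is [::] then 1 else \sum_(S <- Q) sw S)%R Q [:: loop; finish] st.
Proof.
elim: M Q st => [|M IHM].
  case=> [|S Q] st HQ rdy r4 r5; last by case: (HQ S (mem_head _ _)).
  apply: explores_le (explores_nil rdy r4 r5 (lexx _)) => //.
  by rewrite /end_time; lia.
elim=> [|S Q IHQ] st HQ rdy r4 r5.
  apply: explores_le (explores_nil rdy r4 r5 (lexx _)) => //.
  by rewrite /end_time; lia.
have [wfS lt_M] := HQ S (mem_head _ _).
have [clk r2 r3] := rdy.
have single st1 : ready st1 -> st1 4 = dstates [:: S] -> st1 5 = Nil ->
    explores (M.+1 * step_time + end_time) (sw S) [:: S] [:: loop; finish] st1.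
  move=> rdy1 r41 r51; have [clk1 r21 r31] := rdy1.
  have [E_nil|E_nil] := eqVneq S.2 [::].
    apply: (@explores_le (4 + (cost N FAnswer + 6)).+3 _ (sw S) _ [:: S]) => //.
    - by rewrite /step_time /end_time; lia.
    - by move=> T S' S'Q cS'; exists S'.
    apply: explores_while; rewrite /= r41 /=.
    apply: explores_if; rewrite /= r41 /=.
    apply: explores_if; rewrite /= r41 /= E_nil /=.
    pose P st2 := [/\ ready st2, st2 4 = Nil & st2 5 = Cons Nil (dvs S.1)].
    apply: (@explores_reaches _ _ _ _ _ _ _ P); last first.
      by move=> st2 [rdy2 r42 r52]; apply: explores_chosen.
    apply: (@reaches_leq 3) => //.
    apply: reaches_assign_seq; apply: reaches_assign; split.
    - by split; upd.
    - by upd.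
    - by upd; rewrite /= r41.
  have okE := wf_fam_ok wfS leN.
  pose Q' := children d k c S.
  have HQ' S' : S' \in Q' -> wf_state m n S' /\ nverts S' + nbig k S' < M.
    move=> /(children_progress k_gt0 wfS E_nil) [wfS' lt_S']; split=> //.
    by rewrite (leq_trans lt_S').
  have sizeQ' : size Q' <= d + c + 2 by apply: size_children.
  (* A state without children gives one leaf, which [sw_ge1] pays for. *)
  pose w' : R := (if Q' is [::] then 1 else \sum_(S <- Q') sw S)%R.
  have w'_le : (w' <= sw S)%R.
    rewrite /w'; case EQ': Q' => [|S' Q'']; first exact: sw_ge1.
    by rewrite -EQ' sw_children.
  apply: (@explores_le ((cost N (FChildren d k c) + 4 +
    (M * step_time + 5 * size Q' + end_time)).+3) _ w' _ Q') => //.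
  - rewrite [M.+1 * _]mulSn {2}/step_time; move: sizeQ'.
    by move: (M * step_time) (size Q') end_time => X q z; lia.
  - move=> T S'; rewrite inE => /eqP -> cS; exact: (@children_compat m n d k c S wfS E_nil T cS).
  apply: explores_while; rewrite /= r41 /=.
  apply: explores_if; rewrite /= r41 /=.
  apply: explores_if; rewrite /= r41 /=.
  have -> : truthy (dfam S.2) by rewrite truthy_seq; case: (S.2) E_nil.
  pose P st2 := [/\ ready st2, st2 4 = dstates Q' & st2 5 = Nil].
  apply: (@explores_reaches _ _ _ _ _ _ _ P); last first.
    by move=> st2 [rdy2 r42 r52]; apply: IHM.
  apply: (@reaches_leq (cost N (FChildren d k c) + 1).+1.+2); first by lia.
  apply: reaches_assign_seq; apply: reaches_seq; first by apply: comp_reaches; [|upd].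
  move=> st2 [pres eq6]; apply: reaches_assign; split.
  - by split; upd; rewrite pres //; upd.
  - by rewrite update_eq /= eq6; upd; rewrite /= r41 /= den_children.
  - by upd; rewrite pres //; upd.
case: Q IHQ HQ r4 => [|S2 Q] IHQ HQ r4.
  rewrite big_seq1; apply: explores_le (single st rdy r4 r5) => //; first by lia.
  by move=> T S' S'Q cS'; exists S'.
have wQ : (\sum_(S <- S :: S2 :: Q) sw S = sw S + \sum_(S <- S2 :: Q) sw S)%R.
  by rewrite big_cons.
rewrite wQ.
apply: (@explores_le (1 + (M.+1 * step_time + 5 * size (S2 :: Q) + end_time)).+3
  _ (sw S + \sum_(S <- S2 :: Q) sw S)%R _ ([:: S] ++ S2 :: Q)) => //.
- by rewrite /=; lia.
- by move=> T S' S'Q cS'; exists S'.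
apply: explores_while; rewrite /= r4 /=.
apply: explores_if; rewrite /= r4 /=.
apply: (@explores_branch _ _ _ [:: S] (S2 :: Q)).
  pose P st2 := [/\ ready st2, st2 4 = dstates [:: S] & st2 5 = Nil].
  apply: (@explores_reaches _ _ _ _ _ _ _ P).
    apply: reaches_assign; split.
    - by split; upd.
    - by upd; rewrite /= r4.
    - by upd.
  move=> st2 [rdy2 r42 r52].
  apply: explores_le (single st2 rdy2 r42 r52) => //; first by lia.
  by move=> T S' S'Q cS'; exists S'.
pose P st2 := [/\ ready st2, st2 4 = dstates (S2 :: Q) & st2 5 = Nil].
apply: (@explores_reaches _ _ _ _ _ _ _ P).
  apply: reaches_assign; split.
  - by split; upd.
  - by upd; rewrite /= r4.
  - by upd.
move=> st2 [rdy2 r42 r52]; apply: IHQ => // S' S'Q; apply: HQ.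
by rewrite inE S'Q orbT.
Qed.

End Loop.

(** * Construction of the initial state *)

(** The clock is the unary universe, lengthened by one cell per member of the family. The list of
    states starts with the single state in which nothing is chosen. *)
Definition prefix : cmd :=
  Assign 1 (EHd (EVar 0)) ;; Assign 3 (ETl (EVar 0)) ;; Assign 4 (ETl (EVar 0)) ;;
  While (EVar 4) (Assign 1 (ECons ENil (EVar 1)) ;; Assign 4 (ETl (EVar 4))) ;;
  Assign 6 (EVar 0) ;; comp FSystem 6 ;; Assign 2 (EVar 6) ;;
  Assign 4 (ECons (ECons ENil (EVar 2)) ENil).

Definition program d k c : cmd := prefix ;; loop d k c ;; finish.

Definition prefix_time N := N * 4 + cost N FSystem + 15.

Lemma encode_rows n (s : seq {set 'I_n}) :
  tl (encode_system s) = encode_seq encode_bits (rows s).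
Proof. by rewrite encode_seq_map. Qed.

Lemma size_universe n (s : seq {set 'I_n}) : size (unlist (hd (encode_system s))) = n.
Proof. by rewrite unlist_encode_seq size_map size_enum_ord. Qed.

Lemma prefix_reaches n (s : seq {set 'I_n}) (N := n + size s) :
  reaches (prefix_time N) prefix (initial_store s)
    (fun st => [/\ ready N (edges s) (tl (encode_system s)) st,
                   st 4 = dstates [:: ([::], edges s)] & st 5 = Nil]).
Proof.
set rws := tl _; set m := size s.
have rwsE : rws = encode_seq encode_bits (rows s) by apply: encode_rows.
have size_rws : size (unlist rws) = m.
  by rewrite rwsE unlist_encode_seq !size_map.
apply: (@reaches_leq (((m * 4).+1 + (cost N FSystem + 1.+2).+1.+2).+1).+2.+2.+2).
  by rewrite /prefix_time /N -/m; lia.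
do 3 apply: reaches_assign_seq.
(* Here j counts the rows that have not yet lengthened the clock. *)
pose J j st := [/\ st 0 = encode_system s, st 3 = rws,
  size (unlist (st 4)) = j, size (unlist (st 1)) + j = N & st 5 = Nil].
apply: (@reaches_seq _ _ _ _ _ (J 0)).
  apply: (@reaches_while _ _ _ J).
  - by move=> j st [_ _ <- _ _] /=; case: (st 4).
  - move=> j st [H0 H3 H4 H1 H5]; apply: reaches_assign_seq; apply: reaches_assign.
    split; upd => //=.
    + by upd; move: H4; case: (st 4) => //= a b [].
    + by rewrite addSn -addnS.
  - split; upd => //; rewrite /= -/rws.
    rewrite -[X in size (unlist X)]/(hd (encode_system s)) size_universe.
    by rewrite -/m.
move=> st1 [H0 H3 H4 H1 H5]; rewrite addn0 in H1.
apply: reaches_assign_seq; apply: reaches_seq; first by apply: comp_reaches; [|upd].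
move=> st2 [pres eq6]; apply: reaches_assign_seq; apply: reaches_assign.
have E6 : st2 6 = dfam (edges s).
  rewrite eq6; upd; rewrite /= H0.
  have -> : encode_system s =
    Cons (hd (encode_system s)) (encode_seq encode_bits (rows s)).
    by rewrite -encode_rows.
  by rewrite den_system ?size_universe ?size_rows // ?leq_addr ?leq_addl.
split.
- by split; upd => //=; rewrite pres //; upd.
- by upd; rewrite /= update_eq E6.
- by upd; rewrite pres //; upd.
Qed.

Local Open Scope ring_scope.

(** * Constants *)

(** For p = 2^q > q, the choice D = 2 q + 2 gives 2^D = 4 p^2. *)
Lemma exists_exp_dominates (q : nat) : exists D : nat, (0 < D)%N /\ (q * D <= 2 ^ D)%N.
Proof.
exists (2 * q + 2)%N; split; first by lia.
have := ltn_expl q (isT : (1 < 2)%N); rewrite expnD mul2n -addnn expnD.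
by move: (2 ^ q)%N => p lt_qp; nia.
Qed.

(** A converse of Bernoulli's inequality: in the inductive step the cross term 2 e^2 j is at most
    e. *)
Lemma expr_1D_le (R : realFieldType) (e : R) (j : nat) : 0 <= e -> 2 * e * j%:R <= 1 ->
  (1 + e) ^+ j <= 1 + 2 * e * j%:R.
Proof.
move=> e_ge0; elim: j => [|j IH] le1; first by rewrite mulr0 addr0.
have j_ge0 : 0 <= j%:R :> R by [].
have {}IH : (1 + e) ^+ j <= 1 + 2 * e * j%:R.
  by apply: IH; move: le1; rewrite -natr1; nra.
have le1' : 2 * e * j%:R <= 1 by move: le1; rewrite -natr1; nra.
rewrite exprSr (@le_trans _ _ ((1 + 2 * e * j%:R) * (1 + e))) //.
  by rewrite ler_wpM2r // addr_ge0.
by rewrite -natr1; nra.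
Qed.

Section Constants.
Variables (R : realType) (rho D : nat).
Hypotheses (rho_gt0 : (0 < rho)%N) (D_gt0 : (0 < D)%N).
Hypothesis D_big : (2048 * rho * D <= 2 ^ D)%N.

(** The excess of 2 a over 1, for a = [ratio]: small against 2^-D, as small edges require, yet large
    against a^(2 D), of order 4^-D, so as to absorb [grow ^+ n]. *)
Definition del : R := (8 * D%:R * 2 ^+ D)^-1.
Definition ratio : R := (1 + del) / 2.
Definition grow : R := 1 + 2 * ratio ^+ (2 * D).

Let D_ge1 : 1 <= D%:R :> R. Proof. by rewrite ler1n. Qed.
Let rho_ge1 : 1 <= rho%:R :> R. Proof. by rewrite ler1n. Qed.
Let pow_ge1 : 1 <= 2 ^+ D :> R. Proof. by rewrite exprn_ege1 // ler1n. Qed.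
Let pow_ge : 2048 * rho%:R * D%:R <= 2 ^+ D :> R.
Proof. by rewrite -!natrM -natrX ler_nat. Qed.

Lemma del_gt0 : 0 < del.
Proof. by rewrite invr_gt0 !mulr_gt0 ?exprn_gt0 ?ltr0n. Qed.

Lemma del_eq : del * (8 * D%:R * 2 ^+ D) = 1.
Proof. by rewrite mulVf // gt_eqF // !mulr_gt0 ?exprn_gt0 ?ltr0n. Qed.

Lemma ratio_gt0 : 0 < ratio.
Proof. by rewrite divr_gt0 // addr_gt0 // del_gt0. Qed.

Lemma del_pow_le : del * 2 ^+ D <= 1 / 8.
Proof.
have h : 0 <= del * 2 ^+ D * (D%:R - 1).
  by rewrite !mulr_ge0 ?subr_ge0 ?(ltW del_gt0) ?exprn_ge0.
by have := del_eq; move: h; move: (2 ^+ D) => p; lra.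
Qed.

Lemma del_le : del <= 1 / 8.
Proof.
apply: le_trans del_pow_le; rewrite -[leLHS]mulr1 ler_wpM2l //; exact: ltW del_gt0.
Qed.

Lemma ratio_le : ratio <= 3 / 4.
Proof. by have := del_le; rewrite /ratio; lra. Qed.

Lemma pow_1D_del_le j : (j <= 2 * D)%N -> (1 + del) ^+ j <= 2.
Proof.
move=> le_j; have := del_gt0; have := del_le => dle dgt.
have le_j' : j%:R <= 2 * D%:R :> R by rewrite -natrM ler_nat.
have j_ge0 : 0 <= j%:R :> R by [].
have dD : del * D%:R <= 1 / 8.
  have h : 0 <= del * D%:R * (2 ^+ D - 1).
    by rewrite !mulr_ge0 ?subr_ge0 ?(ltW dgt).
  by have := del_eq; move: h; move: (2 ^+ D) => p; lra.
have le1 : 2 * del * j%:R <= 1 by nra.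
by have := expr_1D_le (ltW dgt) le1; lra.
Qed.

Lemma ratio_pow_le j : (j <= 2 * D)%N -> ratio ^+ j * 2 ^+ j <= 2.
Proof. by move=> le_j; rewrite -exprMn /ratio divfK ?pnatr_eq0 // pow_1D_del_le. Qed.

Lemma small_sum_le1 l : (l <= D.-1)%N -> \sum_(0 <= i < l) ratio ^+ i.+1 <= 1.
Proof.
move=> le_l; have dgt := del_gt0; have dp := del_pow_le.
have half_ge j : (j <= D)%N -> 4 * del <= 2^-1 ^+ j.
  move=> le_j; rewrite exprVn -[_^-1]mul1r ler_pdivlMr ?exprn_gt0 //.
  have : 2 ^+ j <= 2 ^+ D :> R by rewrite ler_weXn2l // ler1n.
  by move=> /(ler_wpM2l (ltW dgt)); lra.
(* The geometric sum for 1/2 plus a uniform error 2 [del], which the gap 2^-l, at least 4 [del],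
   absorbs. *)
suff : \sum_(0 <= i < l) ratio ^+ i.+1 <= 1 - 2^-1 ^+ l + 2 * del.
  by have := half_ge l (leq_trans le_l (leq_pred D)); lra.
elim: l le_l => [|l IH] le_l; first by rewrite big_geq // expr0; lra.
rewrite big_nat_recl //.
under eq_bigr do rewrite exprS.
rewrite -mulr_sumr.
have {}IH := IH (ltnW le_l).
have h := half_ge l.+1 (leq_trans le_l (leq_pred D)).
rewrite exprS in h *; rewrite expr1 {1 2}/ratio.
move: (\sum_(0 <= i < l) _) (2^-1 ^+ l) IH h => s p IH h.
by nra.
Qed.

(** The first term is at most 3/4; the second is at most 1/256, because a^D <= 2 / 2^D and 2^D >=
    2048 rho D. *)
Lemma low_sum_le1 : ratio + ratio ^+ D.-1.+1 * (4 * D * rho)%:R <= 1.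
Proof.
rewrite prednK // !natrM; have := ratio_le; have := @ratio_pow_le D.
have : 0 <= ratio ^+ D by rewrite exprn_ge0 // ltW // ratio_gt0.
move: (ratio ^+ D) => p p_ge0 /(_ _) H; have {}H : p * 2 ^+ D <= 2 by apply: H; lia.
move=> r_le.
have : p * (2048 * rho%:R * D%:R) <= 2 by apply: le_trans H; rewrite ler_wpM2l.
by nra.
Qed.

Lemma ratio_big_pow_le : ratio ^+ (2 * D) * (64 * rho%:R) <= del.
Proof.
have dgt := del_gt0; have deq := del_eq.
have := @ratio_pow_le (2 * D) (leqnn _).
have : 0 <= ratio ^+ (2 * D) by rewrite exprn_ge0 // ltW // ratio_gt0.
rewrite [2 ^+ (2 * D)]exprM [2 ^+ 2 ^+ D](_ : _ = 2 ^+ D * 2 ^+ D); last first.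
  by rewrite -exprMn -expr2.
move: (ratio ^+ _) (2 ^+ D) pow_ge pow_ge1 deq => p q q_ge q_ge1 deq p_ge0 H.
(* One of the two factors q in p q^2 <= 2 is replaced by its lower bound. *)
have e1 : p * q * (2048 * rho%:R * D%:R) <= 2.
  by apply: le_trans H; rewrite -mulrA ler_wpM2l // ler_wpM2l //; lra.
have : p * (64 * rho%:R) * (8 * D%:R * q) <= del * (8 * D%:R * q).
  by rewrite deq; nra.
have Dq_gt0 : 0 < 8 * D%:R * q.
  have q_gt0 : 0 < q by lra.
  by rewrite !mulr_gt0 // ltr0n.
by rewrite ler_pM2r.
Qed.

(** For p = a^(2 D) <= 1/2, one has 1 / (1 - p) <= 1 + 2 p. *)
Lemma grow_le : 1 + ratio ^+ (2 * D) * grow <= grow.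
Proof.
have p_ge0 : 0 <= ratio ^+ (2 * D) by rewrite exprn_ge0 // ltW // ratio_gt0.
have := ratio_big_pow_le; have := del_le; rewrite /grow; move: (ratio ^+ _) p_ge0.
move=> p p_ge0 dle ple; have h : 0 <= p * (rho%:R - 1) by rewrite mulr_ge0 ?subr_ge0.
have p_le : p <= 1 / 2 by lra.
by nra.
Qed.

(** Apply ln (1 + z) <= z to 1 / (1 + del) = 1 - del / (1 + del). *)
Lemma ln_1D_del_ge : del / 2 <= ln (1 + del).
Proof.
have dgt := del_gt0; have dle := del_le.
have d1_gt0 : 0 < 1 + del by lra.
have h : ln (1 + (- (del / (1 + del)))) <= - (del / (1 + del)).
  apply: le_ln1Dx; rewrite ltrN2 ltr_pdivrMr //; lra.
have e : 1 + (- (del / (1 + del))) = (1 + del)^-1.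
  by field; rewrite gt_eqF.
rewrite e lnV ?posrE // lerN2 in h; apply: le_trans h.
by rewrite ler_pM2l // lef_pV2 ?posrE //; lra.
Qed.

(** A quarter of the binary logarithm of 1 + del. Of the gain (1 + del)^m in a^-m = 2^m (1 +
    del)^-m, the cap at m/2 costs at most one half and [grow ^+ n] at most one quarter. *)
Definition saving : R := ln (1 + del) / (4 * ln 2).

Lemma saving_gt0 : 0 < saving.
Proof.
have dgt := del_gt0; have lge := ln_1D_del_ge.
have l2 : 0 < ln 2 :> R by rewrite ln_gt0 // ltr1n.
by apply: divr_gt0; [lra | apply: mulr_gt0].
Qed.

Lemma weight_le_powR m n : (n <= rho * m)%N ->
  weight ratio (1 + del) grow m./2 m n <= 2 `^ ((1 - saving) * m%:R).
Proof.
move=> le_n; have dgt := del_gt0; have lge := ln_1D_del_ge.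
have d1_gt0 : 0 < 1 + del by lra.
have ln2 : 0 < ln 2 :> R by rewrite ln_gt0 // ltr1n.
set lam := ln (1 + del) in lge *.
have E1 : 1 + del = expR lam by rewrite lnK ?posrE.
have E2 : 2 = expR (ln 2) :> R by rewrite lnK ?posrE.
have ratioE : ratio^-1 = expR (ln 2 - lam).
  by rewrite expRB -E1 -E2 /ratio invf_div.
have growE : grow <= expR (2 * ratio ^+ (2 * D)) by apply: expR_ge1Dx.
have p_ge0 : 0 <= ratio ^+ (2 * D) by rewrite exprn_ge0 // ltW // ratio_gt0.
have ple := ratio_big_pow_le.
rewrite /weight (minn_idPr _); last by rewrite -divn2 leq_div.
rewrite /powR pnatr_eq0 /= ratioE E1 -!expRM_natl.
apply: (@le_trans _ _ (expR (m%:R * (ln 2 - lam)) * expR (m./2%:R * lam) *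
    expR (2 * ratio ^+ (2 * D)) ^+ n)).
  rewrite ler_wpM2l ?mulr_ge0 ?expR_ge0 // lerXn2r ?nnegrE ?expR_ge0 //.
  by rewrite addr_ge0 // mulr_ge0.
rewrite -expRM_natl -!expRD ler_expR.
have h1 : m./2%:R * 2 <= m%:R :> R.
  by rewrite -natrM ler_nat muln2 -{2}(odd_double_half m) leq_addl.
have h2 : n%:R <= rho%:R * m%:R :> R by rewrite -natrM ler_nat.
have m_ge0 : 0 <= m%:R :> R by [].
have lam_ge0 : 0 <= lam by lra.
have h3 : m./2%:R * lam <= m%:R * lam / 2.
  by have := ler_wpM2r lam_ge0 h1; lra.
(* With p = [ratio ^+ (2 * D)], this follows from n <= rho m and 64 rho p <= del <= 2 lam. *)
have h4 : n%:R * (2 * ratio ^+ (2 * D)) <= m%:R * lam / 4.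
  have := ler_wpM2r p_ge0 h2; have := mulr_ge0 lam_ge0 m_ge0.
  have : ratio ^+ (2 * D) * (64 * rho%:R) * m%:R <= 2 * lam * m%:R.
    by rewrite ler_wpM2r //; lra.
  by move: (ratio ^+ _) => p; lra.
have -> : (1 - saving) * m%:R * ln 2 = m%:R * ln 2 - m%:R * lam / 4.
  by rewrite /saving -/lam; field; rewrite gt_eqF.
by lra.
Qed.

End Constants.

(** * The algorithm *)

Lemma explores_seq (R : realFieldType) m n N E0 rws p (w : R) Q c1 c2 ks st :
  explores m n N E0 rws p w Q (c1 :: c2 :: ks) st ->
  explores m n N E0 rws p.+1 w Q ((c1 ;; c2) :: ks) st.
Proof.
by move=> [t [H1 H2 H3 H4 H5]]; exists (Step t); split=> //; apply: STSeq.
Qed.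

Definition program_time d k c N : nat :=
  prefix_time N + (N.+1 * step_time N d k c + 5 + end_time N) + 2.

Lemma program_time_poly_bounded d k c : poly_bounded (program_time d k c).
Proof.
rewrite /program_time /prefix_time /step_time /end_time.
have poly_S : poly_bounded succn by exists 1%N, 1%N => N; rewrite mul1n expn1.
by do ?[exact: poly_bounded_const | exact: poly_bounded_id | exact: cost_poly_bounded
  | exact: poly_S | apply: poly_bounded_add | apply: poly_bounded_mul].
Qed.

Lemma program_explores (R : realFieldType) (a y x : R) (u0 n d k c : nat)
    (F : {set {set 'I_n}}) (s : seq {set 'I_n}) (N := (n + size s)%N) :
  (0 < k)%N -> 0 < a -> a <= 1 -> 1 <= y -> 1 <= x -> y = 2 * a ->
  (forall l, (l <= d)%N -> \sum_(0 <= i < l) a ^+ i.+1 <= 1) ->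
  1 + a ^+ k * x <= x -> a + a ^+ d.+1 * c%:R <= 1 ->
  (forall u, (c.+1 * u <= k * n)%N -> (u <= u0)%N) ->
  perm_eq s (enum F) ->
  explores (size s) n N (edges s) (tl (encode_system s)) (program_time d k c N)
    (weight a y x u0 (size s) n) [:: ([::], edges s)] [:: program d k c]
    (initial_store s).
Proof.
move=> k_gt0 a_gt0 a_le1 y_ge1 x_ge1 y_eq small_le1 big_le low_le1 high_le sF.
have wf0 := edges_wf s.
set m := size s in N wf0 *.
pose S0 : state := ([::], edges s).
have u_le : (nverts S0 <= m)%N.
  rewrite -[m](size_iota 0); apply: uniq_leq_size; first exact: undup_uniq.
  move=> v /mem_verts [e eS ve]; case: wf0 => _ _ _ /(_ e eS) [_ /allP lt_e _].
  by rewrite mem_iota; apply: lt_e.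
have b_le : (nbig k S0 <= n)%N.
  by case: wf0 => _ _ sE _; apply: leq_trans (count_size _ _) sE.
pose sw := sweight a y x u0 k.
have sw_le : sw S0 <= weight a y x u0 m n.
  have := @weight_le _ a y x u0 a_gt0 a_le1 y_ge1 x_ge1 0 _ m _ n.
  by rewrite mul1r => H; apply: H; rewrite ?addn0.
(* The initial measure is at most m + n = N, hence below [N.+1]. *)
pose p := (N.+1 * step_time N d k c + 5 * size [:: S0] + end_time N)%N.
apply: (@explores_le _ _ _ _ _ _ (prefix_time N + p.+1).+1 _ (sw S0) _ [:: S0]) => //.
- by rewrite /program_time /p /=; lia.
- by move=> T S' S'Q cS'; exists S'.
apply: explores_seq; apply: explores_reaches (prefix_reaches s) _ => st [rdy r4 r5].
apply: explores_seq.
have := @loop_explores R m n N d k c sw (edges s) (tl (encode_system s)) k_gt0.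
move=> /(_ _ _ _ N.+1 [:: S0] st); rewrite big_seq1; apply=> //.
- by move=> S; apply: weight_ge1.
- by move=> S wfS nzS; apply: sweight_children wfS nzS.
- move=> S; rewrite inE => /eqP ->; split=> //.
  by rewrite ltnS /N addnC leq_add.
Qed.

(** Soundness comes from the test at the leaves, completeness from following the index set of a
    minimal cover down the tree. *)
Lemma enumerates_explored n (F : {set {set 'I_n}})
    (s : seq {set 'I_n}) (N := (n + size s)%N) t :
  perm_eq s (enum F) ->
  (forall l, l \in leaves t -> l = Nil \/ exists2 I, wf_state (size s) n (I, [::]) &
     l = out N (edges s) (tl (encode_system s)) I) ->
  (forall T S, S \in [:: ([::], edges s)] -> compat T S ->
     exists2 I, wf_state (size s) n (I, [::]) /\ compat T (I, [::]) &
       out N (edges s) (tl (encode_system s)) I \in leaves t) ->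
  enumerates s t (minimal_set_cover F).
Proof.
move=> sF sound complete; have wf0 := edges_wf s.
have leN : (n + size s <= N)%N by [].
have size_rws : size (unlist (tl (encode_system s))) = size s.
  by rewrite encode_rows unlist_encode_seq !size_map.
have outE I : wf_state (size s) n (I, [::]) ->
    out N (edges s) (tl (encode_system s)) I =
    if minimal_hitting I (edges s)
    then Cons Nil (encode_bits (mask_of I (size s))) else Nil.
  move=> wfI; rewrite /out den_answer ?size_rws ?leq_addl //.
    exact: (wf_chosen_ok wfI).
  exact: (wf_fam_ok wf0).
split.
  move=> l /sound [->|[I wfI ->]]; first by left.
  rewrite (outE I wfI); case: ifP => [hit|_]; last by left.
  right; case: (wfI) => _ ltI _ _.
  have [C minC ->] := minimal_hitting_cover sF ltI hit.
  by exists C.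
move=> C minC; have c0 := minimal_cover_compat sF minC.
have [I [wfI cI]] := complete _ _ (mem_head _ _) c0.
have [hit eqI] := compat_minimal_hitting c0 cI.
by rewrite (outE I wfI) hit (mask_of_indices eqI).
Qed.

Theorem theorem10 (R : realType) (r : R) (r_gt0 : 0 < r) :
  exists (eps : R) (P : cmd) (c k : nat),
    0 < eps /\
    forall (n : nat) (F : {set {set 'I_n}}) (s : seq {set 'I_n}),
      perm_eq s (enum F) ->
      n%:R <= r * #|F|%:R ->
      exists t : stree,
        [/\ search_tree [:: P] (initial_store s) t,
            enumerates s t (minimal_set_cover F),
            (path_time t <= c * (n + #|F|).+1 ^ k)%N &
            (total_time t)%:R <=
              c%:R * (n + #|F|).+1%:R ^+ k * 2 `^ ((1 - eps) * #|F|%:R)].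
Proof.
(* Round r up to a positive integer, since the parameters of the program are natural numbers. *)
have [rho rho_gt0 le_rho] : exists2 rho : nat, (0 < rho)%N & r <= rho%:R.
  have lt_r := archi_boundP (ltW r_gt0); exists (Num.bound r); last exact: ltW.
  by rewrite -(ltr0n R) (lt_trans r_gt0).
have [D [D_gt0 D_big]] := exists_exp_dominates (2048 * rho).
have [c [k time_le]] := program_time_poly_bounded D.-1 (2 * D) (4 * D * rho).
(* Small edges have size below D, hence at most [D.-1]. *)
exists (saving R D), (program D.-1 (2 * D) (4 * D * rho)), c, k.
split; first exact: saving_gt0.
move=> n F s sF le_n.
have size_s : size s = #|F| by rewrite (perm_size sF) -cardE.
have {}le_n : (n <= rho * size s)%N.
  rewrite -(ler_nat R) natrM size_s (le_trans le_n) //.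
  by rewrite ler_wpM2r.
have [||||||||||t [treet sound complete path_t leaves_t]] :=
  @program_explores R (ratio R D) (1 + del R D) (grow R D) (size s)./2 n D.-1 (2 * D)
    (4 * D * rho) F s _ _ _ _ _ _ _ _ _ _ sF.
- by lia.
- exact: ratio_gt0.
- by have := ratio_le R D_gt0; lra.
- by have := del_gt0 R D_gt0; lra.
- by rewrite lerDl mulr_ge0 // exprn_ge0 // ltW // ratio_gt0.
- by rewrite /ratio mulrCA divff ?mulr1 // pnatr_eq0.
- by move=> l le_l; apply: small_sum_le1.
- exact: (grow_le R rho_gt0 D_gt0 D_big).
- exact: low_sum_le1.
- move=> u le_u.
  (* From 4 D rho u <= 2 D n <= 2 D rho m. *)
  have le_u' : (2 * u <= size s)%N by nia.
  by rewrite -(doubleK u) half_leq // -mul2n.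
exists t; rewrite -size_s in le_n *; split=> //.
- exact: enumerates_explored sF sound complete.
- exact: leq_trans path_t (time_le _).
- have w_le := le_trans leaves_t (weight_le_powR R D_gt0 D_big le_n).
  apply: (@le_trans _ _ ((size (leaves t))%:R * (path_time t)%:R)).
    by rewrite -natrM ler_nat total_time_le.
  rewrite mulrC -natrX -natrM ler_pM // ler_nat.
  exact: leq_trans path_t (time_le _).
Qed.
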